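(* Let $\mathbb{F}$ be a field and $\mathcal{A}$ a supersolvable central hyperplane arrangement in $\mathbb{R}^\ell$. Then the associated graded ring $\mathcal{V}_\mathbb{F}(\mathcal{A})$ is Koszul.
   Context: $\mathcal{A}=\{H_1,\dots,H_n\}$, $H_i=\{\mathbf{x}: v_i\cdot\mathbf{x}=0\}$ distinct hyperplanes, $H_i^+=\{v_i\cdot\mathbf{x}>0\}$. $VG_\mathbb{F}(\mathcal{A})$ is the ring of all functions from the set of chambers (connected components of $\mathbb{R}^\ell\setminus\bigcup_iH_i$) to $\mathbb{F}$ with pointwise operations; it is generated by the Heaviside functions $x_i$ ($x_i(C)=1$ if $C\subseteq H_i^+$, else $0$). With $F_d$ the $\mathbb{F}$-span of products of at most $d$ Heaviside functions ($F_{-1}=0$), $\mathcal{V}_\mathbb{F}(\mathcal{A})=\bigoplus_{d\ge0}F_d/F_{d-1}$, a commutative standard graded $\mathbb{F}$-algebra generated in degree $1$. $\mathcal{A}$ is supersolvable if its intersection lattice $\mathcal{L}(\mathcal{A})$ (all intersections of subsets of the hyperplanes, ordered by reverse inclusion) is supersolvable: there is a maximal chain $\Delta$ such that for every chain $K$ the sublattice generated by $\Delta$ and $K$ is distributive. A commutative standard graded $\mathbb{F}$-algebra $R=\mathbb{F}[e_1,\dots,e_n]/I$ ($I$ homogeneous, $\deg e_i=1$) is Koszul if the minimal graded free resolution of $\mathbb{F}=R/R_+$ over $R$ has all nonzero matrix entries of its differentials homogeneous of degree $1$. *)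

(* Defs.v *)
From HB Require Import structures.
From mathcomp Require Import all_boot all_order all_algebra.
From mathcomp Require Import generic_quotient ring_quotient.
From mathcomp Require Import all_classical all_reals topology normedtype.

Set Implicit Arguments.
Unset Strict Implicit.
Unset Printing Implicit Defensive.

Import Order.TTheory GRing.Theory Num.Theory.
Import numFieldNormedType.Exports.

Local Open Scope classical_set_scope.
Local Open Scope ring_scope.
Local Open Scope quotient_scope.

Section Supersolvable.
Context {d : Order.disp_t} (L : latticeType d).

Definition chain (K : set L) : Prop := total_on K (fun x y => (x <= y)%O).

Definition maximal_chain (K : set L) : Prop :=
  chain K /\ forall K' : set L, chain K' -> K `<=` K' -> K' = K.

Definition sublattice (S : set L) : Prop :=
  forall x y, S x -> S y -> S (Order.meet x y) /\ S (Order.join x y).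

Definition generated_sublattice (G : set L) : set L := smallest sublattice G.

Definition distributive_in (S : set L) : Prop :=
  forall x y z, S x -> S y -> S z ->
    Order.meet x (Order.join y z)
      = Order.join (Order.meet x y) (Order.meet x z).

Definition supersolvable : Prop :=
  exists D : set L, maximal_chain D /\
    forall K : set L, chain K ->
      distributive_in (generated_sublattice (D `|` K)).

End Supersolvable.

Section Span.
Context {F : fieldType} {V : lmodType F}.

Definition span (S : set V) : set V :=
  [set v | exists s : seq (F * V),
     (forall p, p \in s -> S p.2) /\ v = \sum_(p <- s) p.1 *: p.2].

Lemma span_ind (S P : set V) :
  P 0 -> (forall a u v, S u -> P v -> P (a *: u + v)) -> span S `<=` P.
Proof.
move=> P0 PS v [s [sS ->]]; elim: s sS => [|p s IH] sS; first by rewrite big_nil.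
rewrite big_cons; apply: PS; first by apply: sS; rewrite mem_head.
by apply: IH => q qs; apply: sS; rewrite in_cons qs orbT.
Qed.

Lemma span0 (S : set V) : span S 0.
Proof. by exists [::]; rewrite big_nil. Qed.

Lemma spanZD (S : set V) a u v : S u -> span S v -> span S (a *: u + v).
Proof.
move=> Su [s [sS ->]]; exists ((a, u) :: s); rewrite big_cons; split=> // p.
by rewrite in_cons => /orP[/eqP->|/sS].
Qed.

Lemma mem_span (S : set V) u : S u -> span S u.
Proof. by move=> Su; rewrite -[u]addr0 -[u]scale1r; apply: spanZD (span0 _). Qed.

Lemma spanD (S : set V) u v : span S u -> span S v -> span S (u + v).
Proof.
move=> Su Sv; move: u Su; apply: span_ind; first by rewrite /mkset add0r.
by move=> a u w Su; rewrite /mkset -addrA; apply: spanZD.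
Qed.

Lemma spanZ (S : set V) a u : span S u -> span S (a *: u).
Proof.
move: u; apply: span_ind; first by rewrite /mkset scaler0; apply: span0.
by move=> b u w Su; rewrite /mkset scalerDr scalerA; apply: spanZD.
Qed.

Lemma spanN (S : set V) u : span S u -> span S (- u).
Proof. by move=> Su; rewrite -scaleN1r; apply: spanZ. Qed.

Lemma span_sum (S : set V) (I : Type) (r : seq I) (f : I -> V) :
  (forall i, span S (f i)) -> span S (\sum_(i <- r) f i).
Proof. by move=> Sf; elim/big_ind: _ => //; [apply: span0|apply: spanD]. Qed.

Lemma span_mono (S T : set V) : S `<=` T -> span S `<=` span T.
Proof.
move=> ST; apply: span_ind; first exact: span0.
by move=> a u v /ST; apply: spanZD.
Qed.

End Span.

Lemma spanM (F : fieldType) (V : comAlgType F) (S T U : set V) :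
  (forall u v, S u -> T v -> U (u * v)) ->
  forall u v, span S u -> span T v -> span U (u * v).
Proof.
move=> STU u v Su Tv; move: u Su.
apply: span_ind; first by rewrite /mkset mul0r; apply: span0.
move=> a u w Su Uw; rewrite /mkset mulrDl -scalerAl; apply: spanD => //.
apply: spanZ; move: v Tv {Uw}.
apply: span_ind; first by rewrite /mkset mulr0; apply: span0.
move=> b v z Tv Uz; rewrite /mkset mulrDr -scalerAr.
by apply: spanZD => //; apply: STU.
Qed.

Definition monomials (F : fieldType) (V : comAlgType F) (n : nat)
    (e : 'I_n -> V) (d : nat) : set V :=
  [set m | exists w : seq 'I_n, size w = d /\ m = \prod_(i <- w) e i].

(* [sga_hom d] is the homogeneous part of degree [d].  The last field says
   that the algebra is a quotient of a polynomial ring in finitely many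
   variables of degree 1; with the others it makes the ideal of relations
   homogeneous.  For d = 0 it gives that the part of degree 0 consists of the
   scalars. *)
Record stdGradedAlg (F : fieldType) := StdGradedAlg {
  sga_alg :> comAlgType F;
  sga_hom : nat -> set sga_alg;
  sga_hom1 : sga_hom 0%N 1;
  sga_homD : forall d a u v,
    sga_hom d u -> sga_hom d v -> sga_hom d (a *: u + v);
  sga_homM : forall d e u v,
    sga_hom d u -> sga_hom e v -> sga_hom (d + e)%N (u * v);
  sga_hom_cover : forall u, exists (m : nat) (c : nat -> sga_alg),
    (forall d, sga_hom d (c d)) /\ u = \sum_(d < m) c d;
  sga_hom_direct : forall (m : nat) (c : nat -> sga_alg),
    (forall d, sga_hom d (c d)) -> \sum_(d < m) c d = 0 ->
    forall d, (d < m)%N -> c d = 0;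
  sga_hom_gen : exists (n : nat) (e : 'I_n -> sga_alg),
    (forall i, sga_hom 1%N (e i)) /\
    (forall d, sga_hom d `<=` span (monomials e d))
}.

Section Koszul.
Variables (F : fieldType) (A : stdGradedAlg F).

Definition irrelevant_ideal : set A :=
  [set u | exists (m : nat) (c : nat -> A),
     (forall d, sga_hom d.+1 (c d)) /\ u = \sum_(d < m) c d].

(* A minimal graded free resolution of A / A_+ as an A-module:
     ... -> A^(mgr_rank 2) -> A^(mgr_rank 1) -> A^(mgr_rank 0) -> A / A_+ -> 0.
   Free modules are spaces of row vectors, on which the differentials act by
   right multiplication, and the k-th basis vector of the i-th module has
   degree [mgr_shift i k].  The augmentation is [u |-> u *m mgr_aug mod A_+].
   Ranks are finite because A is Noetherian. *)
Record minGradedRes := MinGradedRes {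
  mgr_rank : nat -> nat;
  mgr_shift : forall i, 'I_(mgr_rank i) -> nat;
  mgr_aug : 'cV[A]_(mgr_rank 0);
  mgr_diff : forall i, 'M[A]_(mgr_rank i.+1, mgr_rank i);
  mgr_aug_hom : forall j, sga_hom (mgr_shift j) (mgr_aug j 0);
  mgr_diff_hom : forall i j k, mgr_diff i j k != 0 ->
    (mgr_shift k <= mgr_shift j)%N /\
    sga_hom (mgr_shift j - mgr_shift k) (mgr_diff i j k);
  mgr_aug_surj : forall a : A, exists u : 'rV[A]_(mgr_rank 0),
    irrelevant_ideal ((u *m mgr_aug) 0 0 - a);
  mgr_exact0 : forall u : 'rV[A]_(mgr_rank 0),
    irrelevant_ideal ((u *m mgr_aug) 0 0) <->
    exists w : 'rV[A]_(mgr_rank 1), u = w *m mgr_diff 0;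
  mgr_exact : forall i (u : 'rV[A]_(mgr_rank i.+1)),
    u *m mgr_diff i = 0 <->
    exists w : 'rV[A]_(mgr_rank i.+2), u = w *m mgr_diff i.+1;
  mgr_minimal : forall i j k, irrelevant_ideal (mgr_diff i j k)
}.

(* Minimal graded free resolutions exist and are unique up to isomorphism of
   graded complexes, which preserves the degrees of the matrix entries. *)
Definition koszul : Prop :=
  exists M : minGradedRes, forall i j k,
    mgr_diff M i j k != 0 -> sga_hom 1%N (mgr_diff M i j k).

End Koszul.

Section AssociatedGraded.
Variables (F : fieldType) (V : comAlgType F) (n : nat) (x : 'I_n -> V).

Definition filtration (d : nat) : set V :=
  span [set m | exists w : seq 'I_n,
          (size w <= d)%N /\ m = \prod_(i <- w) x i].

(* [filtration_pred d] is F_(d-1), with F_(-1) = 0. *)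
Definition filtration_pred (d : nat) : set V :=
  if d is e.+1 then filtration e else [set 0].

Lemma filtration1 : filtration 0 1.
Proof. by apply: mem_span; exists [::]; rewrite big_nil. Qed.

Lemma filtration_le d e : (d <= e)%N -> filtration d `<=` filtration e.
Proof.
by move=> de; apply: span_mono => m [w [wd ->]]; exists w; split=> //;
   apply: leq_trans de.
Qed.

Lemma filtrationM d e u v :
  filtration d u -> filtration e v -> filtration (d + e)%N (u * v).
Proof.
apply: spanM => {}u {}v [w [wd ->]] [z [ze ->]]; exists (w ++ z).
by rewrite size_cat leq_add // big_cat.
Qed.

Lemma filtration_pred0 d : filtration_pred d 0.
Proof. by case: d => //= d; apply: span0. Qed.

Lemma filtration_predB d u v :
  filtration_pred d u -> filtration_pred d v -> filtration_pred d (u - v).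
Proof.
case: d => [-> ->|d /= du dv]; first by rewrite /= subr0.
by apply: spanD; [exact: du|apply: spanN; exact: dv].
Qed.

Lemma filtration_predM d e u v :
  filtration d u -> filtration_pred e v -> filtration_pred (d + e)%N (u * v).
Proof.
case: e => [du ->|e du ev]; first by rewrite mulr0; apply: filtration_pred0.
by rewrite addnS; apply: filtrationM.
Qed.

Lemma filtration_predD d u v :
  filtration_pred d u -> filtration_pred d v -> filtration_pred d (u + v).
Proof.
move=> du dv; rewrite -[v]opprK; apply: filtration_predB => //.
by rewrite -sub0r; apply: filtration_predB => //; apply: filtration_pred0.
Qed.

(* The direct sum of the F_d, as a subring of V[X]: the polynomials whose
   coefficient of degree d lies in F_d. *)
Definition rees_pred : {pred {poly V}} :=
  fun p => `[< forall d, filtration d p`_d >].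

Lemma rees_subring : subring_closed rees_pred.
Proof.
split=> [|p q /asboolP hp /asboolP hq|p q /asboolP hp /asboolP hq];
  apply/asboolP => d.
- rewrite coef1; case: d => [|d] /=; first exact: filtration1.
  exact: span0.
- by rewrite coefB; apply: spanD; [exact: hp|apply: spanN; exact: hq].
- rewrite coefM; apply: span_sum => i.
  by have := filtrationM (hp i) (hq (d - i)%N); rewrite subnKC // -ltnS.
Qed.

HB.instance Definition _ :=
  GRing.isSubringClosed.Build {poly V} rees_pred rees_subring.

Record rees := Rees { rees_val : {poly V}; rees_valP : rees_val \in rees_pred }.

HB.instance Definition _ := [isSub for rees_val].
HB.instance Definition _ := [Choice of rees by <:].
HB.instance Definition _ := [SubChoice_isSubComNzRing of rees by <:].

Lemma rees_coef (p : rees) d : filtration d (val p)`_d.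
Proof. by have /asboolP := rees_valP p. Qed.

(* The direct sum of the F_(d-1), an ideal of the direct sum of the F_d. *)
Definition rees_ideal : {pred rees} :=
  fun p => `[< forall d, filtration_pred d (val p)`_d >].

Lemma rees_idealP : idealr_closed rees_ideal.
Proof.
split=> [||a u v /asboolP hu /asboolP hv].
- by apply/asboolP => d; rewrite raddf0 coef0; apply: filtration_pred0.
- apply/asboolP => /(_ 0%N); rewrite rmorph1 coef1 => /eqP /=.
  by rewrite oner_eq0.
- apply/asboolP => d; rewrite rmorphD rmorphM /= coefD.
  apply: filtration_predD => //; rewrite coefM.
  elim/big_ind: _ => [|? ?|i _]; [exact: filtration_pred0| |].
    exact: filtration_predD.
  have := filtration_predM (rees_coef a i) (hu (d - i)%N).
  by rewrite subnKC // -ltnS.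
Qed.

HB.instance Definition _ := isIdealr.Build rees rees_ideal rees_idealP.

(* The quotient of the direct sum of the F_d by that of the F_(d-1), i.e.
   the direct sum of the F_d / F_(d-1). *)
Definition gr : Type := {ideal_quot rees_ideal}.

HB.instance Definition _ := GRing.ComNzRing.on gr.

Definition gr_class : rees -> gr := \pi_{ideal_quot rees_ideal}.

HB.instance Definition _ := GRing.RMorphism.on gr_class.


Lemma rees_constP (a : F) : (a%:A)%:P \in rees_pred.
Proof.
apply/asboolP => d; rewrite coefC; case: d => [|d]; last exact: span0.
by apply: spanZ; apply: filtration1.
Qed.

Definition rees_const (a : F) : rees := Rees (rees_constP a).

Definition gr_scale (a : F) (u : gr) : gr := gr_class (rees_const a) * u.

Lemma gr_scaleA a b u : gr_scale a (gr_scale b u) = gr_scale (a * b) u.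
Proof.
rewrite /gr_scale mulrA -rmorphM; congr (gr_class _ * u).
by apply: val_inj; rewrite rmorphM /= -polyCM -scalerAl mul1r scalerA.
Qed.

Lemma gr_scale1 : left_id 1 gr_scale.
Proof.
move=> u; rewrite /gr_scale (_ : rees_const 1 = 1) ?rmorph1 ?mul1r //.
by apply: val_inj; rewrite rmorph1 /= scale1r.
Qed.

Lemma gr_scaleDr : right_distributive gr_scale +%R.
Proof. by move=> a u v; apply: mulrDr. Qed.

Lemma gr_scaleDl u : {morph gr_scale^~ u : a b / a + b}.
Proof.
move=> a b; rewrite /gr_scale -mulrDl -rmorphD; congr (gr_class _ * u).
by apply: val_inj; rewrite rmorphD /= -polyCD scalerDl.
Qed.

HB.instance Definition _ := GRing.Zmodule_isLmodule.Build F gr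
  gr_scaleA gr_scale1 gr_scaleDr gr_scaleDl.

Lemma gr_scaleAl (a : F) (u v : gr) : a *: (u * v) = (a *: u) * v.
Proof. exact: mulrA. Qed.

HB.instance Definition _ := GRing.Lmodule_isLalgebra.Build F gr gr_scaleAl.
HB.instance Definition _ := GRing.Lalgebra_isComAlgebra.Build F gr.

(* The image of F_d / F_(d-1) in the direct sum. *)
Definition gr_hom (d : nat) : set gr :=
  [set u | exists (c : V) (p : rees), val p = c *: 'X^d /\ u = gr_class p].

Lemma rees_monomP d (c : V) : filtration d c -> c *: 'X^d \in rees_pred.
Proof.
move=> dc; apply/asboolP => e; rewrite coefZ coefXn.
by case: eqP => [->|_]; rewrite ?mulr1 ?mulr0 //; apply: span0.
Qed.

Lemma gr_class_eq (p q : rees) :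
  (forall d, filtration_pred d ((val p)`_d - (val q)`_d)) ->
  gr_class p = gr_class q.
Proof.
move=> h; apply/eqP; rewrite -Quotient.idealrBE; apply/asboolP => d.
by rewrite raddfB coefB.
Qed.

Lemma gr_class_eq0 (p : rees) :
  gr_class p = 0 -> forall d, filtration_pred d (val p)`_d.
Proof.
move=> /eqP; rewrite -(rmorph0 gr_class) -Quotient.idealrBE subr0.
by move=> /asboolP.
Qed.

Lemma gr_class_scale a (p : rees) : a *: gr_class p = gr_class (rees_const a * p).
Proof. by rewrite rmorphM. Qed.

Lemma gr_hom1 : gr_hom 0 1.
Proof. by exists 1, 1; rewrite !rmorph1 expr0 scale1r. Qed.

Lemma gr_homD d a u v : gr_hom d u -> gr_hom d v -> gr_hom d (a *: u + v).
Proof.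
move=> [c [p [pE ->]]] [b [q [qE ->]]].
exists (a *: c + b), (rees_const a * p + q); split.
  rewrite rmorphD rmorphM /= pE qE mul_polyC scalerA -scalerDl.
  by rewrite -scalerAl mul1r.
by rewrite gr_class_scale -rmorphD.
Qed.

Lemma gr_homM d e u v : gr_hom d u -> gr_hom e v -> gr_hom (d + e) (u * v).
Proof.
move=> [c [p [pE ->]]] [b [q [qE ->]]]; exists (c * b), (p * q).
by rewrite !rmorphM /= pE qE exprD -scalerAl -scalerAr scalerA.
Qed.

Lemma gr_hom_cover (u : gr) : exists (m : nat) (c : nat -> gr),
  (forall d, gr_hom d (c d)) /\ u = \sum_(d < m) c d.
Proof.
pose p := repr u; pose q d := Rees (rees_monomP (rees_coef p d)).
exists (size (val p)), (fun d => gr_class (q d)); split.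
  by move=> d; exists (val p)`_d, (q d).
rewrite -rmorph_sum -[u]reprK -/p; congr (gr_class _); apply: val_inj.
rewrite raddf_sum /= -[LHS]coefK poly_def.
by apply: eq_bigr.
Qed.

Lemma gr_hom_direct (m : nat) (c : nat -> gr) :
  (forall d, gr_hom d (c d)) -> \sum_(d < m) c d = 0 ->
  forall d, (d < m)%N -> c d = 0.
Proof.
move=> /choice[a] /choice[p] hp s0 d dm.
have pE e : val (p e) = a e *: 'X^e by case: (hp e).
have cE e : c e = gr_class (p e) by case: (hp e).
move: s0; under eq_bigr do rewrite cE; rewrite -rmorph_sum => /gr_class_eq0 h.
rewrite cE -(rmorph0 gr_class); apply: gr_class_eq => e; rewrite raddf0 coef0 subr0.
have {h} := h e; rewrite raddf_sum /= pE coef_sum coefZ coefXn.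
case: eqP => [->|_ _]; last by rewrite mulr0; apply: filtration_pred0.
rewrite (bigD1 (Ordinal dm)) //= pE coefZ coefXn eqxx big1 ?addr0 //.
move=> i /negPf id; rewrite pE coefZ coefXn eq_sym.
by rewrite (_ : (i == d :> nat) = false) ?mulr0.
Qed.

Lemma gr_genP i : x i *: 'X^1 \in rees_pred.
Proof.
by apply: rees_monomP; apply: mem_span; exists [:: i]; rewrite big_seq1.
Qed.

(* The class of [x i] in F_1 / F_0. *)
Definition gr_gen (i : 'I_n) : gr := gr_class (Rees (gr_genP i)).

Lemma gr_hom_gen : exists (m : nat) (e : 'I_m -> gr),
  (forall i, gr_hom 1%N (e i)) /\
  (forall d, gr_hom d `<=` span (monomials e d)).
Proof.
exists n, gr_gen; split=> [i|d _ [c [p [pE ->]]]].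
  by exists (x i), (Rees (gr_genP i)).
have dc : filtration d c.
  by have := rees_coef p d; rewrite pE coefZ coefXn eqxx mulr1.
have main : filtration d `<=` [set c | filtration d c /\
    forall p : rees, val p = c *: 'X^d ->
      span (monomials gr_gen d) (gr_class p)].
  apply: span_ind => [|a m {pE}c [w [wd ->]] [{}dc IH]].
    split; first exact: span0.
    move=> {pE}p; rewrite scale0r => p0; rewrite (_ : p = 0) ?rmorph0.
      exact: span0.
    by apply: val_inj; rewrite rmorph0.
  have dw : filtration d (\prod_(i <- w) x i) by apply: mem_span; exists w.
  split; first by apply: spanD => //; apply: spanZ.
  move=> {}p pE; pose q := Rees (rees_monomP dw); pose r := Rees (rees_monomP dc).
  have -> : p = rees_const a * q + r.
    apply: val_inj; rewrite rmorphD rmorphM /= pE mul_polyC scalerDl scalerA.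
    by rewrite -scalerAl mul1r.
  rewrite rmorphD; apply: spanD; last exact: IH.
  rewrite rmorphM; apply: (@spanZ _ _ _ a (gr_class q)).
  case: (ltnP (size w) d) => [lt_wd|ge_wd].
    rewrite (_ : gr_class q = 0); first exact: span0.
    rewrite -(rmorph0 gr_class); apply: gr_class_eq => e; rewrite raddf0 coef0 subr0 /= coefZ coefXn.
    case: eqP => [->|_]; last by rewrite mulr0; apply: filtration_pred0.
    rewrite mulr1; case: d lt_wd {wd IH dc dw pE q r p} => // d wd.
    by apply: mem_span; exists w.
  have {ge_wd} wd' : size w = d by apply/eqP; rewrite eqn_leq wd.
  apply: mem_span; exists w; split=> //.
  rewrite /gr_gen -rmorph_prod; congr (gr_class _); apply: val_inj.
  rewrite rmorph_prod /= -wd'; elim: (w) => [|i s IHs].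
    by rewrite !big_nil scale1r.
  by rewrite !big_cons -IHs /= exprS -scalerAl -scalerAr scalerA.
by case: (main c dc) => _; apply.
Qed.

Definition gr_sga : stdGradedAlg F :=
  StdGradedAlg gr_hom1 gr_homD gr_homM gr_hom_cover gr_hom_direct gr_hom_gen.

End AssociatedGraded.

Definition dot (R : realType) (l : nat) (v y : 'rV[R]_l) : R :=
  \sum_(j < l) v 0 j * y 0 j.

Definition hyp (R : realType) (l : nat) (v : 'rV[R]_l) : set 'rV[R]_l :=
  [set y | dot v y = 0].

(* The vectors v_i are part of the data: they fix the positive sides. *)
Record arrangement (R : realType) (l : nat) := Arrangement {
  nhyp : nat;
  normal : 'I_nhyp -> 'rV[R]_l;
  normal_neq0 : forall i, normal i != 0;
  normal_hyp_inj : injective (fun i => hyp (normal i))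
}.

Section Arrangement.
Variables (R : realType) (l : nat) (A : arrangement R l).

Definition hyperplane (i : 'I_(nhyp A)) : set 'rV[R]_l := hyp (normal i).

Definition pos_halfspace (i : 'I_(nhyp A)) : set 'rV[R]_l :=
  [set y | 0 < dot (normal i) y].

Definition arr_complement : set 'rV[R]_l := ~` \bigcup_i hyperplane i.

Definition chambers : set (set 'rV[R]_l) :=
  [set connected_component arr_complement y | y in arr_complement].

Definition chamber : Type := set_type chambers.

HB.instance Definition _ := Choice.on chamber.

(* On the moment curve t |-> (1, t, t^2, ...) each linear form v_i is a nonzero
   polynomial, so some point avoids all hyperplanes. *)
Lemma arr_complement_neq0 : exists y, arr_complement y.
Proof.
pose q (i : 'I_(nhyp A)) : {poly R} := \sum_(j < l) normal i 0 j *: 'X^j.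
have qN0 i : q i != 0.
  apply: contra (normal_neq0 i) => /eqP qi0; apply/eqP/rowP => j.
  rewrite mxE -(coef0 R j) -qi0 coef_sum (bigD1 j) //= coefZ coefXn eqxx mulr1.
  rewrite big1 ?addr0 // => k /negPf kj.
  by rewrite coefZ coefXn eq_sym val_eqE kj mulr0.
pose Q := \prod_i q i.
have QN0 : Q != 0 by apply/prodf_neq0.
pose s : seq R := [seq k%:R | k <- iota 0 (size Q)].
have [t tQ] : exists t, ~~ root Q t.
  apply: contrapT => rootQ.
  have : (size s < size Q)%N.
    apply: max_poly_roots => //.
      by apply/allP => t _; apply/negPn/negP => tQ; apply: rootQ; exists t.
    by rewrite map_inj_uniq ?iota_uniq //; apply: mulrIn; rewrite oner_eq0.
  by rewrite size_map size_iota ltnn.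
exists (\row_j t ^+ j) => -[i _]; rewrite /hyperplane /hyp /dot /= => vt0.
move/negP: tQ; apply; rewrite /root /Q (bigD1 i) //= hornerM.
rewrite mulf_eq0; apply/orP; left; apply/eqP; rewrite -[RHS]vt0 horner_sum.
by apply: eq_bigr => j _; rewrite hornerZ hornerXn !mxE.
Qed.

Lemma chamber_inhabited : inhabited chamber.
Proof.
have [y cy] := arr_complement_neq0; apply: inhabits.
by exists (connected_component arr_complement y); rewrite inE; exists y.
Qed.

HB.instance Definition _ :=
  isPointed.Build chamber (inhabited_witness chamber_inhabited).

Definition flats : set (set 'rV[R]_l) :=
  [set \bigcap_(i in S) hyperplane i | S in [set: set 'I_(nhyp A)]].

Definition intersection_lattice : Type := set_type flats.

Local Notation L := intersection_lattice.

HB.instance Definition _ := Choice.on L.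

Definition flat_le (X Y : L) : bool := `[< val Y `<=` val X >].

Lemma flat_le_refl : reflexive flat_le.
Proof. by move=> X; apply/asboolP. Qed.

Lemma flat_le_anti : antisymmetric flat_le.
Proof.
move=> X Y /andP[/asboolP YX /asboolP XY].
by apply: val_inj; apply/seteqP; split.
Qed.

Lemma flat_le_trans : transitive flat_le.
Proof.
move=> Y X Z /asboolP YX /asboolP ZY.
by apply/asboolP; apply: subset_trans YX.
Qed.

Fact flat_display : Order.disp_t. Proof. exact: (Order.Disp tt tt). Qed.

HB.instance Definition _ := Order.Le_isPOrder.Build flat_display L
  flat_le_refl flat_le_anti flat_le_trans.

(* The order is reverse inclusion: the join is the intersection, and the meet
   is the intersection of all the hyperplanes that contain both flats. *)
Lemma flat_joinP (X Y : L) : val X `&` val Y \in flats.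
Proof.
have [S _ <-] := set_mem (valP X); have [T _ <-] := set_mem (valP Y).
by rewrite inE; exists (S `|` T) => //; rewrite bigcap_setU.
Qed.

Definition flat_join (X Y : L) : L := SigSub (flat_joinP X Y).

Lemma flat_meetP (X Y : L) :
  \bigcap_(i in [set i | val X `|` val Y `<=` hyperplane i]) hyperplane i
    \in flats.
Proof. by rewrite inE; eexists; last reflexivity. Qed.

Definition flat_meet (X Y : L) : L := SigSub (flat_meetP X Y).

Lemma flat_lexI (X Y Z : L) :
  (X <= flat_meet Y Z)%O = (X <= Y)%O && (X <= Z)%O.
Proof.
apply/asboolP/andP => [h|[/asboolP YX /asboolP ZX]].
  by split; apply/asboolP => y hy; apply: h => i; apply; [left|right].
move: YX ZX; have [S _ <-] := set_mem (valP X) => YX ZX y hy i Si.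
by apply: hy => z [/YX|/ZX]; apply.
Qed.

Lemma flat_leUx (X Y Z : L) :
  (flat_join X Y <= Z)%O = (X <= Z)%O && (Y <= Z)%O.
Proof.
apply/asboolP/andP => [h|[/asboolP XZ /asboolP YZ]].
  by split; apply/asboolP => y /h[].
by move=> y yZ; split; [apply: XZ|apply: YZ].
Qed.

HB.instance Definition _ := Order.POrder_isMeetSemilattice.Build
  flat_display L flat_lexI.
HB.instance Definition _ := Order.POrder_isJoinSemilattice.Build
  flat_display L flat_leUx.

Variable F : fieldType.

Definition VG : Type := chamber -> F.

HB.instance Definition _ := GRing.ComNzRing.copy VG (chamber -> F).
HB.instance Definition _ := GRing.Lmodule.copy VG (chamber -> F^o).

Lemma VG_scaleAl (a : F) (u v : VG) : a *: (u * v) = (a *: u) * v.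
Proof. by apply/funext => C; apply: mulrA. Qed.

HB.instance Definition _ := GRing.Lmodule_isLalgebra.Build F VG VG_scaleAl.
HB.instance Definition _ := GRing.Lalgebra_isComAlgebra.Build F VG.

Definition heaviside (i : 'I_(nhyp A)) : VG :=
  fun C => if `[< val C `<=` pos_halfspace i >] then 1 else 0.

Definition VG_gr : stdGradedAlg F := gr_sga heaviside.

End Arrangement.

(* Main.v *)
From HB Require Import structures.
From mathcomp Require Import all_boot all_order all_algebra all_reals.
From mathcomp Require Import all_classical topology normedtype.
From mathcomp Require Import ring lra zify.
Require Import Defs.

(* A modular maximal chain of flats cuts the hyperplanes into levels such that
   two hyperplanes of one level meet inside a hyperplane of lower level.  In the
   graded ring this gives e_i^2 = 0 and, for i, j of the same level, a relation
   e_i e_j = +-e_k e_i +- e_k e_j with k of lower level, so the monomials with at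
   most one factor per level span.  They are linearly independent: along a line
   parallel to the flat of the lower levels, the hyperplanes of one level are
   crossed at distinct points, and the jump of a Heaviside combination at a
   crossing isolates a coefficient.
   Sort the generators by level.  With this basis the colon ideal (W) : e_j, for a
   set W that contains all e_i of lower level but neither e_j nor any of higher level,
   is generated by the e_i of level at most that of e_j.  So the initial segments
   of the levels form a Koszul filtration, and a Koszul filtration yields a linear
   resolution: a module of syzygies whose generators have successive colon ideals
   in the filtration has a module of syzygies of the same kind. *)

Set Implicit Arguments.
Unset Strict Implicit.
Unset Printing Implicit Defensive.

Import Order.TTheory GRing.Theory Num.Theory.
Import numFieldNormedType.Exports.
Local Open Scope classical_set_scope.
Local Open Scope ring_scope.

(** * Linear independence *)

Lemma sub_span (F : fieldType) (V : lmodType F) (S T : set V) :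
  S `<=` span T -> span S `<=` span T.
Proof.
move=> ST; apply: span_ind; first exact: span0.
by move=> a u v /ST Tu Tv; apply: spanD => //; apply: spanZ.
Qed.

Section Independence.
Variables (F : fieldType) (V : lmodType F) (I : finType) (b : I -> V).
Implicit Types (Q : pred I) (c : I -> F).

Definition independent Q : Prop := forall c,
  \sum_(i | Q i) c i *: b i = 0 -> forall i, Q i -> c i = 0.

Lemma span_imageP Q u :
  span (b @` [set i | Q i]) u <-> exists c, u = \sum_(i | Q i) c i *: b i.
Proof.
split=> [|[c ->]]; last first.
  rewrite big_mkcond; apply: span_sum => i.
  by case: ifP => [Qi|_]; [apply/spanZ/mem_span; exists i|apply: span0].
move: u; apply: span_ind => [|a _ _ [i Qi <-] [c ->]].
  by exists (fun=> 0); rewrite big1 // => i _; rewrite scale0r.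
exists (fun j => (j == i)%:R * a + c j).
under [RHS]eq_bigr do rewrite scalerDl.
rewrite big_split /= [X in _ = X + _](bigD1 i) //= eqxx mul1r.
rewrite [X in _ = _ + X + _]big1 ?addr0 // => j /andP[_ /negPf->].
by rewrite mul0r scale0r.
Qed.

Lemma independent_span_disjoint Q Q1 Q2 c :
  independent Q -> subpred Q1 Q -> subpred Q2 Q -> (forall i, Q1 i -> ~~ Q2 i) ->
  span (b @` [set i | Q2 i]) (\sum_(i | Q1 i) c i *: b i) ->
  forall i, Q1 i -> c i = 0.
Proof.
move=> indQ sQ1 sQ2 Q12 /span_imageP[d cdE] i Q1i.
have restrict Q' (f : I -> F) : subpred Q' Q ->
    \sum_(j | Q j) (if Q' j then f j else 0) *: b j = \sum_(j | Q' j) f j *: b j.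
  move=> sQ'; rewrite (bigID Q') /= [X in _ + X]big1 ?addr0.
    by apply: eq_big => [j|j /andP[_ ->] //]; apply: andb_idl; apply: sQ'.
  by move=> j /andP[_ /negPf->]; rewrite scale0r.
pose cd j := (if Q1 j then c j else 0) - (if Q2 j then d j else 0).
have cd0 : \sum_(j | Q j) cd j *: b j = 0.
  under eq_bigr do rewrite scalerBl.
  by rewrite sumrB !restrict // cdE subrr.
by have := indQ cd cd0 i (sQ1 i Q1i); rewrite /cd Q1i (negPf (Q12 i Q1i)) subr0.
Qed.

End Independence.

(** * Homogeneous components *)

Section HomogeneousComponents.
Variables (F : fieldType) (A : stdGradedAlg F).
Implicit Types (u v : A) (c : nat -> A) (d e : nat).

Lemma sga_hom0 d : sga_hom d (0 : A).
Proof.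
have [_ [c [hc _]]] := sga_hom_cover (0 : A).
by have := sga_homD (-1) (hc d) (hc d); rewrite scaleN1r addNr.
Qed.

Lemma sga_homN d u : sga_hom d u -> sga_hom d (- u).
Proof.
by move=> hu; rewrite -[- u]addr0 -scaleN1r; apply: sga_homD hu (sga_hom0 d).
Qed.

Lemma sga_homB d u v : sga_hom d u -> sga_hom d v -> sga_hom d (u - v).
Proof. by move=> hu /sga_homN hv; rewrite -[u]scale1r; apply: sga_homD. Qed.

Definition homogeneous_decomposition u c : Prop :=
  (forall d, sga_hom d (c d)) /\
  exists m, forall N, (m <= N)%N -> u = \sum_(d < N) c d.

Lemma ex_homogeneous_decomposition u : exists c, homogeneous_decomposition u c.
Proof.
have [m [c [hc ->]]] := sga_hom_cover u.
exists (fun d => if (d < m)%N then c d else 0); split=> [d|].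
  by case: ifP => // _; apply: sga_hom0.
by exists m => N mN; rewrite -big_mkcond /= (big_ord_widen_cond N xpredT c mN).
Qed.

Lemma homogeneous_decomposition_uniq u c c' :
  homogeneous_decomposition u c -> homogeneous_decomposition u c' -> c =1 c'.
Proof.
move=> [hc [m cE]] [hc' [m' c'E]] d; apply/eqP; rewrite -subr_eq0; apply/eqP.
pose N := maxn d.+1 (maxn m m').
apply: (sga_hom_direct (m := N) (c := fun e => c e - c' e)); last first.
- by rewrite leq_maxl.
- by rewrite sumrB -cE ?leq_max ?leqnn ?orbT // -c'E ?subrr // !leq_max leqnn !orbT.
- by move=> e; apply: sga_homB.
Qed.

Definition hom_component d u : A := sval (cid (ex_homogeneous_decomposition u)) d.

Lemma hom_componentP u : homogeneous_decomposition u (hom_component^~ u).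
Proof. exact: svalP. Qed.

Lemma sga_hom_component d u : sga_hom d (hom_component d u).
Proof. by have [] := hom_componentP u. Qed.

Lemma hom_component_is_linear d : linear (hom_component d).
Proof.
move=> a u v.
have [[hu [m uE]] [hv [m' vE]]] := (hom_componentP u, hom_componentP v).
apply: (homogeneous_decomposition_uniq (hom_componentP _) (c' := fun d =>
  a *: hom_component d u + hom_component d v)).
split=> [e|]; first exact: sga_homD.
exists (maxn m m') => N; rewrite geq_max => /andP[mN m'N].
by rewrite big_split /= -scaler_sumr -uE // -vE.
Qed.

HB.instance Definition _ d :=
  GRing.isLinear.Build F A A *:%R (hom_component d) (hom_component_is_linear d).

Lemma hom_component_hom d e u :
  sga_hom e u -> hom_component d u = if d == e then u else 0.
Proof.
move=> hu; apply: (homogeneous_decomposition_uniq (hom_componentP u)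
  (c' := fun d => if d == e then u else 0)); split=> [i|].
  by case: eqP => [->|_]; last exact: sga_hom0.
by exists e.+1 => N eN; rewrite -big_mkcond /= (big_pred1 (Ordinal eN)).
Qed.

Lemma hom_componentM d e u v : sga_hom e v ->
  hom_component d (u * v) = if (e <= d)%N then hom_component (d - e) u * v else 0.
Proof.
move=> hv; have [hu [m uE]] := hom_componentP u.
apply: (homogeneous_decomposition_uniq (hom_componentP (u * v)) (c' := fun d =>
  if (e <= d)%N then hom_component (d - e) u * v else 0)); split=> [i|].
  case: ifP => [ei|_]; last exact: sga_hom0.
  by rewrite -{1}(subnK ei); apply: sga_homM.
exists (m + e)%N => N meN; have eN := leq_trans (leq_addl m e) meN.
rewrite {1}(uE (N - e)%N) ?leq_subRL ?[(e + m)%N]addnC // mulr_suml.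
rewrite -(big_mkord xpredT (fun i =>
  if (e <= i)%N then hom_component (i - e) u * v else 0)).
rewrite (big_cat_nat (n := e)) //= big_nat_cond [X in _ = X + _]big1 ?add0r => [|i];
  last by move=> /andP[/andP[_ /ltn_geF->]].
rewrite -[X in \big[_/_]_(X <= _ < _) _]add0n big_addn big_mkord; apply: eq_bigr => i _.
by rewrite leq_addl addnK.
Qed.

Lemma irrelevant_idealP u : irrelevant_ideal u <-> hom_component 0 u = 0.
Proof.
split=> [[m [c [hc ->]]]|u0].
  by rewrite raddf_sum big1 // => d _; rewrite /= (hom_component_hom _ (hc d)).
have [hu [m uE]] := hom_componentP u.
exists m, (fun d => hom_component d.+1 u); split=> //.
by rewrite {1}(uE m.+1) // big_ord_recl /= u0 add0r.
Qed.

Definition hom_mx d m r (D : 'M[A]_(m, r)) : Prop := forall i j, sga_hom d (D i j).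

Lemma hom_mx_left_factor d e p m r (f : 'M[A]_(p, r)) w (D : 'M[A]_(m, r)) :
  hom_mx d D -> hom_mx (e + d) f -> f = w *m D ->
  exists2 w', hom_mx e w' & f = w' *m D.
Proof.
move=> hD hf fE; exists (map_mx (hom_component e) w) => [i j|].
  by rewrite mxE; apply: sga_hom_component.
apply/matrixP => i j; have := hom_component_hom (e + d) (hf i j); rewrite eqxx => <-.
rewrite fE !mxE raddf_sum; apply: eq_bigr => k _.
by rewrite /= (hom_componentM _ _ (hD k j)) leq_addl addnK mxE.
Qed.

End HomogeneousComponents.

(** * Koszul filtrations *)

Section RowSpans.
Variable A : comNzRingType.

Definition row_span m r (D : 'M[A]_(m, r)) : set 'rV[A]_r :=
  [set u | exists w, u = w *m D].

Definition syzygies m r (D : 'M[A]_(m, r)) : set 'rV[A]_m := [set u | u *m D = 0].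

Lemma mulmx_row_col_mx m r (u : 'rV[A]_(1 + m)) (v : 'rV[A]_r) (D : 'M[A]_(m, r)) :
  u *m col_mx v D = lsubmx u 0 0 *: v + rsubmx u *m D.
Proof.
by rewrite -{1}[u]hsubmxK mul_row_col {1}[lsubmx u]mx11_scalar mul_scalar_mx.
Qed.

Lemma row_span_col_mx m r (v : 'rV[A]_r) (D : 'M[A]_(m, r)) u :
  row_span (col_mx v D) u <-> exists a, row_span D (u - a *: v).
Proof.
split=> [[w ->]|[a [w uE]]].
  by exists (lsubmx w 0 0), (rsubmx w); rewrite mulmx_row_col_mx addrAC subrr add0r.
by exists (row_mx a%:M w); rewrite mul_row_col mul_scalar_mx -uE addrC subrK.
Qed.

Lemma row_span_row_mx0 m r (D : 'M[A]_(m, r)) :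
  row_span (row_mx (0 : 'M_(m, 1)) D) =
  [set u | lsubmx u 0 0 = 0 /\ row_span D (rsubmx u)].
Proof.
apply/seteqP; split=> u.
  move=> [w ->]; rewrite mul_mx_row mulmx0 /= row_mxKl row_mxKr mxE.
  by split=> //; exists w.
move=> [u0 [w uE]]; exists w; rewrite mul_mx_row mulmx0 -uE -[LHS]hsubmxK.
by rewrite [lsubmx u]mx11_scalar u0 raddf0.
Qed.

Lemma row_span_syzygies_nil r (D : 'M[A]_(0, r)) : row_span (0 : 'M_0) = syzygies D.
Proof.
apply/seteqP; split=> u _; first by rewrite /syzygies /= [u]thinmx0 mul0mx.
by exists 0; rewrite mul0mx; apply: thinmx0.
Qed.

End RowSpans.

Section LinearResolutions.
Variables (F : fieldType) (A : stdGradedAlg F).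

Variable P : forall m r, 'M[A]_(m, r) -> Prop.
Hypothesis P_linear : forall m r (D : 'M[A]_(m, r)), P D -> hom_mx 1 D.
Hypothesis P_syzygies : forall m r (D : 'M[A]_(m, r)), P D ->
  exists m' (D' : 'M[A]_(m', m)), P D' /\ row_span D' = syzygies D.
Hypothesis P_irrelevant : exists m (D : 'M[A]_(m, 1)),
  P D /\ row_span D = [set u | irrelevant_ideal (u 0 0)].

Record presentation := Presentation {
  pres_rows : nat;
  pres_cols : nat;
  pres_mx : 'M[A]_(pres_rows, pres_cols);
  pres_mxP : P pres_mx
}.

Lemma ex_syzygy_presentation (X : presentation) :
  exists mD : {m & 'M[A]_(m, pres_rows X)},
    P (projT2 mD) /\ row_span (projT2 mD) = syzygies (pres_mx X).
Proof. by have [m [D hD]] := P_syzygies (pres_mxP X); exists (existT _ m D). Qed.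

Definition syzygy_presentation (X : presentation) : presentation :=
  Presentation (proj1 (svalP (cid (ex_syzygy_presentation X)))).

Lemma row_span_syzygy_presentation (X : presentation) :
  row_span (pres_mx (syzygy_presentation X)) = syzygies (pres_mx X).
Proof. exact: proj2 (svalP (cid (ex_syzygy_presentation X))). Qed.

Lemma koszul_of_linear_syzygies : koszul A.
Proof.
have [m [D [PD DE]]] := P_irrelevant.
pose X i := iter i syzygy_presentation (Presentation PD).
have X_linear i : hom_mx 1 (pres_mx (X i)) by apply/P_linear/pres_mxP.
have augE (u : 'rV[A]_1) : (u *m const_mx 1 : 'M_1) 0 0 = u 0 0.
  by rewrite mxE big_ord1 mxE mulr1.
unshelve eexists; first apply: (@MinGradedRes F A (fun i => pres_cols (X i))
    (fun i _ => i) (const_mx 1) (fun i => pres_mx (X i))).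
- by move=> j; rewrite mxE; apply: sga_hom1.
- by move=> i j k _; rewrite subSnn; split; last apply: X_linear.
- move=> a; exists a%:M; rewrite augE mxE subrr.
  by apply/irrelevant_idealP; rewrite raddf0.
- by move=> u; rewrite augE -[irrelevant_ideal _]/([set u | _] u) -DE.
- move=> i u; rewrite -[_ = 0]/(syzygies (pres_mx (X i)) u).
  by rewrite -row_span_syzygy_presentation.
- move=> i j k; apply/irrelevant_idealP.
  by rewrite (hom_component_hom _ (X_linear i j k)).
- by move=> i j k _; apply: X_linear.
Qed.

End LinearResolutions.

Section Ideals.
Variable A : comNzRingType.
Implicit Types (a b x : A) (s : seq A) (J : set A).

Fixpoint ideal_of s : set A :=
  if s is x :: s' then [set a | exists b, ideal_of s' (a - b * x)] else [set 0].

Definition colon J x : set A := [set a | J (a * x)].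

Lemma ideal_of0 s : ideal_of s 0.
Proof. by elim: s => //= x s IHs; exists 0; rewrite mul0r subr0. Qed.

Lemma ideal_of_cons x s a : ideal_of s a -> ideal_of (x :: s) a.
Proof. by exists 0; rewrite mul0r subr0. Qed.

Lemma ideal_ofD s a b : ideal_of s a -> ideal_of s b -> ideal_of s (a + b).
Proof.
elim: s a b => [|x s IHs] a b /=; first by move=> -> ->; rewrite addr0.
move=> [c ac] [d bd]; exists (c + d); rewrite mulrDl opprD addrACA.
exact: IHs.
Qed.

Lemma ideal_ofMl s a b : ideal_of s b -> ideal_of s (a * b).
Proof.
elim: s b => [|x s IHs] b /=; first by move=> ->; rewrite mulr0.
by move=> [c bc]; exists (a * c); rewrite -mulrA -mulrBr; apply: IHs.
Qed.

Lemma mem_ideal_of s x : x \in s -> ideal_of s x.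
Proof.
elim: s => // y s IHs; rewrite in_cons => /predU1P[->|/IHs]; last exact: ideal_of_cons.
by exists 1; rewrite mul1r subrr; apply: ideal_of0.
Qed.

Lemma ideal_of_ind s (J : set A) :
  J 0 -> (forall a x b, x \in s -> J b -> J (a * x + b)) -> ideal_of s `<=` J.
Proof.
move=> J0; elim: s => [_ _ -> //|x s IHs JD a [c ac]].
rewrite -[a](subrKC (c * x)); apply: (JD _ _ _ (mem_head _ _)).
by apply: IHs ac => b y d ys; apply: JD; rewrite in_cons ys orbT.
Qed.

End Ideals.

Lemma ideal_ofZ (F : fieldType) (A : comAlgType F) (s : seq A) (a : F) (b : A) :
  ideal_of s b -> ideal_of s (a *: b).
Proof. by rewrite -[b in a *: b]mul1r scalerAl; apply: ideal_ofMl. Qed.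

Section KoszulFiltrations.
Variables (F : fieldType) (A : stdGradedAlg F).

(* Conca, Trung and Valla's notion, with each ideal given by an ordered list of
   generators: the next smaller ideal is the one generated by the tail. *)
Definition koszul_filtration (K : set (seq A)) : Prop :=
  (exists2 s, K s & ideal_of s = @irrelevant_ideal F A) /\
  forall x s, K (x :: s) ->
    [/\ sga_hom 1 x, K s & exists2 t, K t & ideal_of t = colon (ideal_of s) x].

Variable K : set (seq A).
Hypothesis filtK : koszul_filtration K.

Inductive linear_quotients r : forall m, 'M[A]_(m, r) -> Prop :=
| linear_quotients_nil (D : 'M[A]_(0, r)) : linear_quotients D
| linear_quotients_cons m (v : 'rV[A]_r) (D : 'M[A]_(m, r)) s :
    hom_mx 1 v -> linear_quotients D -> K s ->
    ideal_of s = [set a | row_span D (a *: v)] -> linear_quotients (col_mx v D).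

Lemma linear_quotients_hom m r (D : 'M[A]_(m, r)) : linear_quotients D -> hom_mx 1 D.
Proof.
elim=> {m D} [D|m v D s hv _ hD _ _] i j; first by case: i.
by case: (split_ordP i) => k ->; rewrite ?col_mxEu ?col_mxEd.
Qed.

Lemma linear_quotients_row_mx0 m r (D : 'M[A]_(m, r)) :
  linear_quotients D -> linear_quotients (row_mx (0 : 'M_(m, 1)) D).
Proof.
elim=> {m D} [D|m v D s hv _ IHD Ks sE]; first exact: linear_quotients_nil.
have -> : row_mx (0 : 'M_(1 + m, 1)) (col_mx v D) = col_mx (row_mx 0 v) (row_mx 0 D).
  by rewrite -col_mx0 -block_mxEh -block_mxEv.
apply: (@linear_quotients_cons _ _ _ _ s) => // [i j|].
  by case: (split_ordP j) => k ->; rewrite ?row_mxEl ?row_mxEr ?mxE //; apply: sga_hom0.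
rewrite sE; apply/seteqP; split=> a [w].
  by rewrite /= => avE; exists w; rewrite scale_row_mx mul_mx_row scaler0 mulmx0 avE.
by rewrite scale_row_mx mul_mx_row => /eq_row_mx[_ avE]; exists w.
Qed.

Lemma ex_linear_syzygy m r (v : 'rV[A]_r) (D : 'M[A]_(m, r)) g :
  hom_mx 1 v -> hom_mx 1 D -> sga_hom 1 g -> row_span D (g *: v) ->
  exists y, [/\ hom_mx 1 y, syzygies (col_mx v D) y & lsubmx y 0 0 = g].
Proof.
move=> hv hD hg [w0 gvE].
have [|w hw {}gvE] := hom_mx_left_factor (e := 1) hD _ gvE.
  by move=> i j; rewrite mxE; apply: (@sga_homM _ _ 1 1).
exists (row_mx g%:M (- w)); split.
- move=> i j; rewrite ord1; case: (split_ordP j) => k ->.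
    by rewrite row_mxEl mxE ord1.
  by rewrite row_mxEr mxE; apply: sga_homN.
- by rewrite /syzygies /= mul_row_col mul_scalar_mx gvE mulNmx subrr.
- by rewrite row_mxKl mxE.
Qed.

(* Ordered by the generators [s] of an ideal in which the first coordinate
   lies, the syzygies have again linear quotients: the new colon ideals are
   the colon ideals of the filtration. *)
Lemma syzygies_col_mx m r (v : 'rV[A]_r) (D : 'M[A]_(m, r)) m1 (D1 : 'M[A]_(m1, m)) s :
  hom_mx 1 v -> hom_mx 1 D -> linear_quotients D1 -> row_span D1 = syzygies D ->
  K s -> ideal_of s `<=` [set a | row_span D (a *: v)] ->
  exists m' (D' : 'M[A]_(m', 1 + m)), linear_quotients D' /\
    row_span D' = syzygies (col_mx v D) `&` [set u | ideal_of s (lsubmx u 0 0)].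
Proof.
move=> hv hD qD1 D1E; elim: s => [_ _|g s IHs Kgs sub].
  exists m1, (row_mx 0 D1); split; first exact: linear_quotients_row_mx0.
  rewrite row_span_row_mx0 D1E; apply/seteqP; split=> u.
    by move=> [u0 uD]; split; rewrite // /syzygies /= mulmx_row_col_mx u0 scale0r add0r.
  by rewrite /syzygies /= mulmx_row_col_mx => -[+ u0]; rewrite u0 scale0r add0r.
have [hg Ks [t Kt tE]] := filtK.2 _ _ Kgs.
have [m' [D' [qD' D'E]]] := IHs Ks (fun a sa => sub _ (ideal_of_cons _ sa)).
have g_colon := sub g (mem_ideal_of (mem_head g s)).
have [y [hy y_syz y0]] := ex_linear_syzygy hv hD hg g_colon.
have syzB (u : 'rV_(1 + m)) a :
    syzygies (col_mx v D) (u - a *: y) = syzygies (col_mx v D) u.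
  by rewrite /syzygies /= mulmxBl -scalemxAl y_syz scaler0 subr0.
have lsubB (u : 'rV_(1 + m)) a :
    lsubmx (u - a *: y) 0 0 = lsubmx u 0 0 - a * g.
  by rewrite linearB linearZ /= -y0 !mxE.
exists (1 + m')%N, (col_mx y D'); split.
  apply: (linear_quotients_cons (s := t)) => //.
  rewrite tE D'E; apply/seteqP; split=> a; rewrite /colon /= linearZ mxE y0.
    by split=> //; rewrite /syzygies /= -scalemxAl y_syz scaler0.
  by case.
apply/seteqP; split=> u; rewrite row_span_col_mx D'E /=.
  by move=> [a]; rewrite syzB lsubB => -[su sa]; split=> //; exists a.
by move=> [su [a sa]]; exists a; rewrite syzB lsubB.
Qed.

Lemma syzygies_linear_quotients m r (D : 'M[A]_(m, r)) : linear_quotients D ->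
  exists m' (D' : 'M[A]_(m', m)), linear_quotients D' /\ row_span D' = syzygies D.
Proof.
elim=> {m D} [D|m v D s hv qD [m1 [D1 [qD1 D1E]]] Ks sE].
  exists 0, 0; split; first exact: linear_quotients_nil.
  exact: row_span_syzygies_nil.
have hD := linear_quotients_hom qD.
have [|m' [D' [qD' D'E]]] := syzygies_col_mx hv hD qD1 D1E Ks; first by rewrite sE.
exists m', D'; split=> //; rewrite D'E; apply/setIidPl => u.
rewrite /syzygies /= sE mulmx_row_col_mx => /eqP; rewrite addr_eq0 => /eqP uE.
by exists (- rsubmx u); rewrite uE mulNmx.
Qed.

(* Every scalar is a syzygy of the zero vector of the zero module, so the ideal
   is an instance of [syzygies_col_mx]. *)
Lemma filtration_linear_quotients s : K s ->
  exists m (D : 'M[A]_(m, 1)),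
    linear_quotients D /\ row_span D = [set u | ideal_of s (u 0 0)].
Proof.
move=> Ks; pose D0 : 'M[A]_0 := 0; pose v0 : 'rV[A]_0 := 0.
have qD0 : linear_quotients D0 by apply: linear_quotients_nil.
have [] := @syzygies_col_mx _ _ v0 D0 _ D0 s _ _ qD0 (row_span_syzygies_nil D0) Ks.
- by move=> i [].
- by move=> [].
- by move=> a _; exists 0; rewrite mul0mx; apply: thinmx0.
move=> m [D [qD DE]]; exists m, D; split=> //; rewrite DE.
apply/seteqP; split=> u /=; rewrite mxE lshift0; first by case.
by move=> su; split=> //; apply: thinmx0.
Qed.

Theorem koszul_of_koszul_filtration : koszul A.
Proof.
apply: (@koszul_of_linear_syzygies F A (fun m r => @linear_quotients r m)).
- by move=> m r D; apply: linear_quotients_hom.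
- by move=> m r D; apply: syzygies_linear_quotients.
- by have [[s Ks <-] _] := filtK; apply: filtration_linear_quotients.
Qed.

End KoszulFiltrations.

(** * Straightening and colon ideals *)

Lemma big_set_in (R : Type) (idx : R) (op : Monoid.com_law idx) (I : finType) (i : I)
    (Q : pred {set I}) (G : {set I} -> R) :
  \big[op/idx]_(T : {set I} | (i \in T) && Q T) G T =
  \big[op/idx]_(T : {set I} | (i \notin T) && Q (i |: T)) G (i |: T).
Proof.
rewrite (reindex_onto (fun T : {set I} => i |: T) (fun T : {set I} => T :\ i)) /=.
  apply: eq_bigl => T; rewrite finset.setU11 /= andbC; congr (_ && _).
  by apply/eqP/idP => [<-|/finset.setU1K //]; rewrite finset.setD11.
by move=> T /andP[iT _]; rewrite finset.setD1K.
Qed.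

Section LevelTransversals.
Variables (I : finType) (lev : I -> nat).
Implicit Types (T : {set I}) (i j k : I) (P : pred I).

Definition level_transversal T : bool := dinjectiveb lev T.

Lemma level_transversalU1 i T : level_transversal T ->
  (forall j, j \in T -> lev j != lev i) -> level_transversal (i |: T).
Proof.
move=> /dinjectiveP tT Ti; apply/dinjectiveP => j k.
rewrite !finset.in_setU1 => /orP[/eqP->|jT] /orP[/eqP->|kT] // jk.
- by have := Ti _ kT; rewrite jk eqxx.
- by have := Ti _ jT; rewrite jk eqxx.
- exact: tT.
Qed.

Lemma level_transversalS T T' :
  T \subset T' -> level_transversal T' -> level_transversal T.
Proof.
move=> /fintype.subsetP sT /dinjectiveP tT'.
by apply/dinjectiveP => i j /sT iT' /sT; apply: tT'.
Qed.

Definition lower_closed P : Prop := forall i k, P i -> (lev k < lev i)%N -> P k.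

Lemma lower_closed0 : lower_closed pred0.
Proof. by []. Qed.

Definition meets P T : bool := [exists i in T, P i].

Lemma level_transversal_set_of_seq w :
  uniq (map lev w) -> level_transversal [set i in w].
Proof.
move=> uw; rewrite -[level_transversal _]/(uniq _).
rewrite (perm_uniq (perm_map lev (t := w) _)) //.
apply: uniq_perm (enum_uniq _) (map_uniq uw) _ => i.
by rewrite mem_enum finset.in_set.
Qed.

End LevelTransversals.

Section Straightening.
Variables (F : fieldType) (V : comAlgType F) (I : finType) (lev : I -> nat).
Implicit Types (W : set V) (e : I -> V) (T : {set I}) (i j k : I).
Implicit Types (w : seq I) (P : pred I).

Definition level_relations W e : Prop :=
  (forall i, W (e i * e i)) /\
  forall i j, i != j -> lev i = lev j -> exists k (a b : F),
    (lev k < lev i)%N /\ W (e i * e j - (a *: (e k * e i) + b *: (e k * e j))).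

Definition sqfree_monomial e T : V := \prod_(i in T) e i.

Lemma ex_repeated_level w : ~~ uniq (map lev w) ->
  exists i j w', perm_eq w [:: i, j & w'] /\ lev i = lev j.
Proof.
elim: w => [//|a w IHw] /=; rewrite negb_and negbK => /orP[/mapP[b bw ab]|/IHw].
  by exists a, b, (rem b w); split=> //; rewrite perm_cons perm_to_rem.
move=> [i [j [w' [pw ij]]]]; exists i, j, (a :: w'); split=> //.
rewrite -[[:: i, j, a & w']]/([:: i; j] ++ [:: a] ++ w') perm_sym perm_catCA /=.
by rewrite perm_cons perm_sym.
Qed.

Variable e : I -> V.
Hypothesis e_rel : level_relations [set 0] e.

(* Each use of a relation lowers the sum of the levels, and keeps a factor in
   the lower closed set [P] if there was one. *)
Lemma straightening P w : lower_closed lev P ->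
  span (sqfree_monomial e @` [set T |
      [&& level_transversal lev T, #|T| == size w & has P w ==> meets P T]])
    (\prod_(i <- w) e i).
Proof.
move=> lowP; have [N] := ubnP (\sum_(i <- w) lev i)%N.
elim: N w => // N IHN w wN.
have [uw|/ex_repeated_level[i [j [w' [pw ij]]]]] := boolP (uniq (map lev w)).
  apply: mem_span; exists [set i in w]; last first.
    rewrite [RHS]big_uniq ?(map_uniq uw) //.
    by apply: eq_bigl => i; rewrite finset.in_set.
  rewrite /mkset level_transversal_set_of_seq //= cardsE; apply/andP; split.
    exact/eqP/card_uniqP/(map_uniq uw).
  by apply/implyP => /hasP[i iw Pi]; apply/exists_inP; exists i; rewrite ?finset.in_set.
rewrite (perm_big _ pw) /= !big_cons mulrA.
have [<-|nij] := eqVneq i j; first by rewrite e_rel.1 mul0r; apply: span0.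
have [k [a [b [ki /subr0_eq->]]]] := e_rel.2 _ _ nij ij.
have rewritten h : lev h = lev i ->
    span (sqfree_monomial e @` [set T |
        [&& level_transversal lev T, #|T| == size w & has P w ==> meets P T]])
      (e k * e h * \prod_(l <- w') e l).
  move=> hi; have := IHN [:: k, h & w']; rewrite !big_cons mulrA => IH.
  apply: (span_mono _ (IH _)) => [u [T /and3P[tT sT PT] <-]|]; last first.
    by move: wN; rewrite (perm_big _ pw) /= !big_cons; lia.
  exists T => //; rewrite /mkset tT (eqP sT) (perm_size pw) eqxx (perm_has _ pw) /=.
  apply/implyP => Pw; apply: (implyP PT) => /=; case/or3P: Pw => [Pi|Pj|->].
  - by rewrite (lowP _ _ Pi ki).
  - by rewrite (lowP _ _ Pj) // -ij.
  - by rewrite !orbT.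
by rewrite mulrDl -!scalerAl; apply: spanD; apply: spanZ; apply: rewritten.
Qed.

Hypothesis e_gen : forall u, span [set \prod_(i <- w) e i | w in [set: seq I]] u.

Lemma sqfree_monomial_span u :
  span (sqfree_monomial e @` [set T | level_transversal lev T]) u.
Proof.
apply: (sub_span _ (e_gen u)) => _ [w _ <-].
have := straightening w (@lower_closed0 _ lev); apply: span_mono.
by apply: image_subset => T /and3P[].
Qed.

Lemma ideal_of_monomial_span w u : lower_closed lev (mem w) -> ideal_of (map e w) u ->
  span (sqfree_monomial e @` [set T | level_transversal lev T && meets (mem w) T]) u.
Proof.
move=> low_w; move: u; apply: ideal_of_ind => [|a _ u /mapP[i iw ->] hu].
  exact: span0.
apply: spanD => //; move: a (e_gen a).
apply: span_ind => [|b _ v [w' _ <-] hv]; first by rewrite /mkset mul0r; apply: span0.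
rewrite /mkset mulrDl -scalerAl; apply: spanD => //; apply: spanZ.
have := straightening (i :: w') low_w; rewrite big_cons mulrC; apply: span_mono.
apply: image_subset => T /and3P[tT _ wT]; rewrite /mkset tT.
by apply: (implyP wT); apply/orP; left.
Qed.

Lemma sqfree_monomialU1 j T : j \notin T ->
  sqfree_monomial e (j |: T) = e j * sqfree_monomial e T.
Proof. exact: big_setU1. Qed.

Lemma ideal_of_sqfree_monomial w T :
  meets (mem w) T -> ideal_of (map e w) (sqfree_monomial e T).
Proof.
move=> /exists_inP[i iT iw]; rewrite /sqfree_monomial (bigD1 i) //= mulrC.
by apply/ideal_ofMl/mem_ideal_of/map_f.
Qed.

Lemma ideal_of_lower_mul w i j : (forall k, (lev k < lev j)%N -> k \in w) ->
  (lev i <= lev j)%N -> ideal_of (map e w) (e i * e j).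
Proof.
move=> below; have e_below k u : (lev k < lev j)%N -> ideal_of (map e w) (e k * u).
  by rewrite mulrC => /below kw; apply/ideal_ofMl/mem_ideal_of/map_f.
rewrite leq_eqVlt => /orP[/eqP ij|/e_below] //.
have [->|nij] := eqVneq i j; first by rewrite e_rel.1; apply: ideal_of0.
have [k [a [b [ki /subr0_eq->]]]] := e_rel.2 _ _ nij ij; rewrite ij in ki.
by apply: ideal_ofD; apply: ideal_ofZ; apply: e_below.
Qed.

Hypothesis e_indep : independent (sqfree_monomial e) (level_transversal lev).

(* The monomials that avoid the levels up to that of [j] remain distinct
   transversal monomials after multiplication by [e j], and none of them is
   among those that span the ideal. *)
Lemma ideal_of_mul_avoiding w j (c : {set I} -> F) :
  lower_closed lev (mem w) -> j \notin w ->
  let avoiding T := level_transversal lev T && ~~ meets (fun i => lev i <= lev j)%N T in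
  ideal_of (map e w) ((\sum_(T | avoiding T) c T *: sqfree_monomial e T) * e j) ->
  forall T, avoiding T -> c T = 0.
Proof.
move=> low_w jw avoiding w_sum.
have avoidP T i : avoiding T -> i \in T -> (lev j < lev i)%N.
  by move=> /andP[_ /exists_inPn avT] /avT; rewrite -ltnNge.
have avoid_j T : avoiding T -> j \notin T.
  by move=> avT; apply/negP => /(avoidP _ _ avT); rewrite ltnn.
pose above (S : {set I}) := (j \in S) && avoiding (S :\ j).
have sumE : (\sum_(T | avoiding T) c T *: sqfree_monomial e T) * e j =
    \sum_(S | above S) c (S :\ j) *: sqfree_monomial e S.
  rewrite big_set_in mulr_suml; apply: eq_big => [T|T /avoid_j jT].
    have [jT|jT] := boolP (j \in T); last by rewrite /= finset.setU1K.
    by apply/negP => /avoid_j; rewrite jT.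
  by rewrite finset.setU1K // sqfree_monomialU1 // -scalerAl mulrC.
have c0 S : above S -> c (S :\ j) = 0.
  apply: (independent_span_disjoint (c := fun S => c (S :\ j))
    (Q2 := fun S => level_transversal lev S && meets (mem w) S) e_indep)
    => {S} [S|S|S|].
  - move=> /andP[jS avS]; rewrite -(finset.setD1K jS); have /andP[tS _] := avS.
    by apply: level_transversalU1 => // i /(avoidP _ _ avS); rewrite neq_ltn orbC => ->.
  - by case/andP.
  - move=> /andP[jS avS]; rewrite negb_and; apply/orP; right.
    apply/exists_inPn => i; have [->|ij] := eqVneq i j; first by [].
    move=> iS; apply: contra jw => iw; apply: (low_w i) => //.
    by apply: (avoidP _ _ avS); rewrite finset.in_setD1 ij.
  - by rewrite -sumE; apply: ideal_of_monomial_span.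
move=> T avT; have jT := avoid_j _ avT.
by rewrite -(finset.setU1K jT) c0 // /above finset.setU11 finset.setU1K.
Qed.

Lemma colon_ideal_of w w' j : lower_closed lev (mem w) -> j \notin w ->
  (forall i, (lev i < lev j)%N -> i \in w) ->
  (forall i, (i \in w') = (lev i <= lev j)%N) ->
  ideal_of (map e w') = colon (ideal_of (map e w)) (e j).
Proof.
move=> low_w jw below w'E.
have sub_colon : ideal_of (map e w') `<=` colon (ideal_of (map e w)) (e j).
  apply: ideal_of_ind => [|b _ u /mapP[i iw' ->] wu].
    by rewrite /colon /= mul0r; apply: ideal_of0.
  rewrite /colon /= mulrDl -mulrA; apply: ideal_ofD => //; apply: ideal_ofMl.
  by apply: ideal_of_lower_mul; rewrite // -w'E.
apply/seteqP; split=> // a waj.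
have /span_imageP[c aE] := sqfree_monomial_span a.
rewrite (bigID (meets (fun i => lev i <= lev j)%N)) /= in aE.
set lower := (X in X + _) in aE; set upper := (X in _ + X) in aE.
have w'lower : ideal_of (map e w') lower.
  rewrite /lower; elim/big_ind: _ => [||T /andP[_ w'T]].
  - exact: ideal_of0.
  - exact: ideal_ofD.
  - apply/ideal_ofZ/ideal_of_sqfree_monomial.
    by case/exists_inP: w'T => i iT ij; apply/exists_inP; exists i; rewrite //= w'E.
have c0 := @ideal_of_mul_avoiding w j c low_w jw.
rewrite aE [upper]big1 ?addr0 // => T avT; rewrite c0 ?scale0r //.
have -> : upper * e j = a * e j + (-1) * (lower * e j) by rewrite aE; ring.
by apply: ideal_ofD => //; apply/ideal_ofMl/sub_colon.
Qed.

End Straightening.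

Section LevelFiltrations.
Variables (F : fieldType) (A : stdGradedAlg F).
Variables (n : nat) (e : 'I_n -> A) (lev : 'I_n -> nat).
Implicit Types (w : seq 'I_n) (i j k : 'I_n).

Hypothesis e_hom : forall i, sga_hom 1 (e i).
Hypothesis e_gen : forall d, sga_hom d `<=` span (monomials e d).
Hypothesis e_rel : level_relations lev [set 0] e.
Hypothesis e_indep : independent (sqfree_monomial e) (level_transversal lev).

Lemma words_span (u : A) : span [set \prod_(i <- w) e i | w in [set: seq 'I_n]] u.
Proof.
have [m [c [hc ->]]] := sga_hom_cover u; apply: span_sum => d.
by apply: span_mono (e_gen (hc d)) => _ [w [_ ->]]; exists w.
Qed.

Lemma irrelevant_ideal_of w : (forall i, i \in w) ->
  ideal_of (map e w) = @irrelevant_ideal F A.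
Proof.
move=> w_all; apply/seteqP; split=> u.
  move: u; apply: ideal_of_ind => [|a _ u /mapP[i _ ->] /irrelevant_idealP u0].
    by apply/irrelevant_idealP; rewrite raddf0.
  by apply/irrelevant_idealP; rewrite raddfD /= u0 (hom_componentM _ _ (e_hom i)) addr0.
move=> [m [c [hc ->]]]; elim/big_ind: _ => [||d _].
- exact: ideal_of0.
- exact: ideal_ofD.
move: (c d) (e_gen (hc d)); apply: span_ind => [|a _ v [[|i w'] [// _ ->]] wv].
  exact: ideal_of0.
apply: ideal_ofD => //; apply: ideal_ofZ; rewrite big_cons mulrC.
by apply/ideal_ofMl/mem_ideal_of/map_f.
Qed.

Definition level_filtration : set (seq A) := map e @` [set w |
  [/\ sorted (fun i k => lev k <= lev i)%N w, uniq w & lower_closed lev (mem w)]].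

Definition sort_by_level (P : pred 'I_n) : seq 'I_n :=
  sort (fun i k => lev k <= lev i)%N (enum P).

Lemma mem_sort_by_level P i : (i \in sort_by_level P) = P i.
Proof. by rewrite mem_sort mem_enum. Qed.

Lemma level_filtration_sort P :
  lower_closed lev P -> level_filtration (map e (sort_by_level P)).
Proof.
move=> lowP; exists (sort_by_level P) => //; split.
- by apply: sort_sorted => i k; apply: leq_total.
- by rewrite sort_uniq enum_uniq.
- by move=> i k; rewrite /= !mem_sort_by_level; apply: lowP.
Qed.

Lemma koszul_level_filtration : koszul_filtration level_filtration.
Proof.
split.
  exists (map e (sort_by_level xpredT)); first exact: level_filtration_sort.
  by apply: irrelevant_ideal_of => i; rewrite mem_sort_by_level.
move=> _ _ [[//|j w] [sjw ujw low_jw] [<- <-]].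
have /andP[jw uw] := ujw.
have below i : (lev i < lev j)%N -> i \in w.
  move=> ij; have := low_jw j i (mem_head _ _) ij; rewrite /= in_cons.
  by case: eqP ij => [->|]; rewrite ?ltnn.
have low_w : lower_closed lev (mem w).
  move=> i k iw ki; apply: below; apply: leq_trans ki _.
  have lev_trans : transitive (fun i k => lev k <= lev i)%N.
    by move=> b a c ba cb; apply: leq_trans ba.
  by have /allP/(_ i iw) := order_path_min lev_trans sjw.
split=> //; first by exists w => //; split=> //; apply: path_sorted sjw.
pose P i := (lev i <= lev j)%N; exists (map e (sort_by_level P)).
  by apply: level_filtration_sort => i k /[swap] /ltnW; apply: leq_trans.
apply: (colon_ideal_of e_rel words_span e_indep) => // i.
exact: mem_sort_by_level.
Qed.

Theorem koszul_of_level_relations : koszul A.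
Proof. exact: koszul_of_koszul_filtration koszul_level_filtration. Qed.

End LevelFiltrations.

(** * The associated graded ring *)

Section AssociatedGraded.
Variables (F : fieldType) (V : comAlgType F) (n : nat) (x : 'I_n -> V).
Implicit Types (c b : V) (d : nat) (T : {set 'I_n}).

(* The class in [F_d / F_(d-1)] of an element of [F_d]; junk outside [F_d]. *)
Definition gr_symbol d c : gr x := gr_class (insubd (0 : rees x) (c *: 'X^d)).

Lemma gr_symbol_val d c : filtration x d c ->
  val (insubd (0 : rees x) (c *: 'X^d)) = c *: 'X^d.
Proof. by move=> hc; apply: insubdK; apply: rees_monomP. Qed.

Lemma filtration_rees d c (p : rees x) : val p = c *: 'X^d -> filtration x d c.
Proof. by move=> pE; have := rees_coef p d; rewrite pE coefZ coefXn eqxx mulr1. Qed.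

Lemma gr_class_symbol d c (p : rees x) :
  val p = c *: 'X^d -> gr_class p = gr_symbol d c.
Proof.
move=> pE; congr (gr_class _); apply: val_inj; rewrite pE gr_symbol_val //.
exact: filtration_rees pE.
Qed.

Lemma gr_homP d u : gr_hom d u <-> exists2 c, filtration x d c & u = gr_symbol d c.
Proof.
split=> [[c [p [pE ->]]]|[c hc ->]].
  by exists c; [apply: filtration_rees pE|apply: gr_class_symbol].
by exists c, (insubd (0 : rees x) (c *: 'X^d)); rewrite gr_symbol_val.
Qed.

Lemma gr_symbolZD d (a : F) c b : filtration x d c -> filtration x d b ->
  gr_symbol d (a *: c + b) = a *: gr_symbol d c + gr_symbol d b.
Proof.
move=> hc hb; rewrite {2 3}/gr_symbol gr_class_scale -rmorphD.
apply/esym/gr_class_symbol.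
rewrite rmorphD rmorphM /= !gr_symbol_val // mul_polyC scalerA -scalerDl.
by rewrite -scalerAl mul1r.
Qed.

Lemma gr_symbol1 : gr_symbol 0 1 = 1.
Proof.
rewrite -(rmorph1 (@gr_class F V n x)); apply/esym/gr_class_symbol.
by rewrite expr0 scale1r rmorph1.
Qed.

Lemma gr_symbolM d d' c b : filtration x d c -> filtration x d' b ->
  gr_symbol (d + d') (c * b) = gr_symbol d c * gr_symbol d' b.
Proof.
move=> hc hb; rewrite /gr_symbol -rmorphM; apply/esym/gr_class_symbol.
by rewrite rmorphM /= !gr_symbol_val // exprD -scalerAl -scalerAr scalerA.
Qed.

Lemma gr_symbol_eq0 d c : filtration x d c ->
  gr_symbol d c = 0 <-> filtration_pred x d c.
Proof.
move=> hc; split=> [/gr_class_eq0/(_ d)|hc'].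
  by rewrite gr_symbol_val // coefZ coefXn eqxx mulr1.
rewrite -(rmorph0 (@gr_class F V n x)); apply: gr_class_eq => d'.
rewrite raddf0 coef0 subr0 gr_symbol_val // coefZ coefXn.
by case: eqP => [->|_]; rewrite ?mulr1 ?mulr0 //; apply: filtration_pred0.
Qed.

Lemma gr_symbol0 d : gr_symbol d 0 = 0.
Proof. by apply/gr_symbol_eq0; [apply: span0|apply: filtration_pred0]. Qed.

Lemma gr_symbolZ d (a : F) c :
  filtration x d c -> gr_symbol d (a *: c) = a *: gr_symbol d c.
Proof.
by move=> hc; rewrite -[a *: c]addr0 gr_symbolZD ?gr_symbol0 ?addr0 //; apply: span0.
Qed.

Lemma gr_symbolD d c b : filtration x d c -> filtration x d b ->
  gr_symbol d (c + b) = gr_symbol d c + gr_symbol d b.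
Proof. by move=> hc hb; rewrite -[c]scale1r gr_symbolZD // !scale1r. Qed.

Lemma gr_symbolB d c b : filtration x d c -> filtration x d b ->
  gr_symbol d (c - b) = gr_symbol d c - gr_symbol d b.
Proof.
by move=> hc hb; rewrite -!scaleN1r gr_symbolD ?gr_symbolZ //; apply: spanZ.
Qed.

Lemma span_gr_symbol d (S : set V) : S `<=` filtration x d ->
  span (gr_symbol d @` S) = gr_symbol d @` span S.
Proof.
move=> Sd; have span_d : span S `<=` filtration x d by apply: sub_span.
apply/seteqP; split.
  apply: span_ind => [|a _ _ [c Sc <-] [b Sb <-]].
    by exists 0; [apply: span0|apply: gr_symbol0].
  by exists (a *: c + b); [apply: spanZD|rewrite gr_symbolZD //; auto].
move=> _ [c Sc <-]; suff [] : (filtration x d `&`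
    [set c | span (gr_symbol d @` S) (gr_symbol d c)]) c by [].
move: c Sc; apply: span_ind => [|a c b Sc [db symb]].
  by split; [apply: span0|rewrite /mkset gr_symbol0; apply: span0].
split; first by apply: spanD => //; apply/spanZ/Sd.
rewrite /mkset gr_symbolZD //; last exact: Sd.
by apply: spanZD => //; exists c.
Qed.

Lemma filtration_word w d : (size w <= d)%N -> filtration x d (\prod_(i <- w) x i).
Proof. by move=> wd; apply: mem_span; exists w. Qed.

Lemma filtration_gen i : filtration x 1 (x i).
Proof. by have := @filtration_word [:: i] 1 isT; rewrite big_seq1. Qed.

Lemma filtration_sqfree T : filtration x #|T| (sqfree_monomial x T).
Proof. by rewrite /sqfree_monomial -big_enum cardE; apply: filtration_word. Qed.

Lemma gr_genE i : gr_gen x i = gr_symbol 1 (x i).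
Proof. exact: gr_class_symbol. Qed.

Lemma prod_gr_gen w :
  \prod_(i <- w) gr_gen x i = gr_symbol (size w) (\prod_(i <- w) x i).
Proof.
elim: w => [|i w IHw]; first by rewrite !big_nil gr_symbol1.
rewrite !big_cons IHw gr_genE -gr_symbolM //; first exact: filtration_gen.
exact: filtration_word.
Qed.

Lemma sqfree_monomial_gr_gen T :
  sqfree_monomial (gr_gen x) T = gr_symbol #|T| (sqfree_monomial x T).
Proof. by rewrite /sqfree_monomial -!big_enum prod_gr_gen -cardE. Qed.

Lemma gr_hom_gr_gen i : gr_hom 1 (gr_gen x i).
Proof. by apply/gr_homP; exists (x i); [apply: filtration_gen|apply: gr_genE]. Qed.

Lemma gr_hom_span d : gr_hom d `<=` span (monomials (gr_gen x) d).
Proof.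
move=> _ /gr_homP[c hc ->].
set words := [set m | exists w : seq 'I_n, (size w <= d)%N /\ m = \prod_(i <- w) x i].
have symbol_c : (gr_symbol d @` span words) (gr_symbol d c) by exists c.
rewrite -span_gr_symbol in symbol_c; last exact: mem_span.
apply: (sub_span _ symbol_c) => _ [_ [w [wd ->]] <-].
have [lt_wd|ge_wd] := ltnP (size w) d; last first.
  have {}wd : size w = d by apply/eqP; rewrite eqn_leq wd.
  by apply: mem_span; exists w; rewrite prod_gr_gen wd.
rewrite (_ : gr_symbol _ _ = 0); first exact: span0.
apply/gr_symbol_eq0; first exact: filtration_word.
by case: d lt_wd {wd symbol_c hc words} => // d; apply: filtration_word.
Qed.

Variable lev : 'I_n -> nat.
Hypothesis x_rel : level_relations lev (filtration x 1) x.
Hypothesis x_indep : independent (sqfree_monomial x) (level_transversal lev).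

Lemma gr_level_relations : level_relations lev [set 0] (gr_gen x : 'I_n -> gr_sga x).
Proof.
have filtration2 i j : filtration x 2 (x i * x j).
  by apply: (@filtrationM _ _ _ _ 1 1); apply: filtration_gen.
have gr_genM i j : gr_gen x i * gr_gen x j = gr_symbol 2 (x i * x j).
  by rewrite !gr_genE -gr_symbolM //; apply: filtration_gen.
split=> [i|i j nij ij]; first by rewrite /mkset gr_genM; apply/gr_symbol_eq0/x_rel.1.
have [k [a [b [ki x_ij]]]] := x_rel.2 i j nij ij; exists k, a, b; split=> //.
have filtration2_ij : filtration x 2 (a *: (x k * x i) + b *: (x k * x j)).
  by apply: spanD; apply/spanZ/filtration2.
rewrite /mkset !gr_genM -!gr_symbolZ // -gr_symbolD; try exact/spanZ/filtration2.
rewrite -gr_symbolB //; apply/gr_symbol_eq0 => //.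
by apply: filtration_le x_ij.
Qed.

Lemma filtration_transversal_span d : filtration x d `<=`
  span (sqfree_monomial x @` [set T | level_transversal lev T && (#|T| <= d)%N]).
Proof.
elim/ltn_ind: d => d IHd c hc.
pose top := sqfree_monomial x @` [set T | level_transversal lev T && (#|T| == d)].
have top_d : top `<=` filtration x d.
  by move=> _ [T /andP[_ /eqP <-] <-]; apply: filtration_sqfree.
have : (gr_symbol d @` span top) (gr_symbol d c).
  rewrite -span_gr_symbol //; have /gr_hom_span : gr_hom d (gr_symbol d c).
    by apply/gr_homP; exists c.
  apply: sub_span => _ [w [wd ->]].
  have := straightening gr_level_relations w (@lower_closed0 _ lev).
  apply: span_mono => _ [T /and3P[tT /eqP sT _] <-].
  exists (sqfree_monomial x T); last by rewrite sqfree_monomial_gr_gen sT wd.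
  by exists T; rewrite // /mkset tT sT wd /=.
move=> [s top_s symbol_s].
have hs : filtration x d s by apply: (sub_span top_d).
have : filtration_pred x d (c - s).
  apply/gr_symbol_eq0; first by apply: spanD => //; apply: spanN.
  by rewrite gr_symbolB // symbol_s subrr.
move=> c_s; rewrite -[c](subrK s); apply: spanD; last first.
  apply: span_mono top_s => _ [T /andP[tT /eqP sT] <-].
  by exists T; rewrite // /mkset tT sT leqnn.
move: (c - s) c_s => z; case: d {hc top top_d top_s symbol_s hs} IHd => [_ ->|d IHd].
  exact: span0.
move=> /(IHd d (leqnn _) z); apply: span_mono => _ [T /andP[tT Td] <-].
by exists T; rewrite // /mkset tT ltnW.
Qed.

Lemma gr_symbol_sum d (I : Type) (r : seq I) (P : pred I) (a : I -> F) (f : I -> V) :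
  (forall i, P i -> filtration x d (f i)) ->
  filtration x d (\sum_(i <- r | P i) a i *: f i) /\
  gr_symbol d (\sum_(i <- r | P i) a i *: f i) =
    \sum_(i <- r | P i) a i *: gr_symbol d (f i).
Proof.
move=> hf; elim/big_rec2: _ => [|i _ c Pi [hc <-]].
  by rewrite gr_symbol0; split=> //; apply: span0.
by rewrite gr_symbolZD; auto; split=> //; apply: spanD => //; apply/spanZ/hf.
Qed.

Lemma gr_independent :
  independent (sqfree_monomial (gr_gen x : 'I_n -> gr_sga x)) (level_transversal lev).
Proof.
move=> c c0 T0 tT0; pose d := #|T0|.
pose top T := level_transversal lev T && (#|T| == d).
have x_top T : top T -> filtration x d (sqfree_monomial x T).
  by move=> /andP[_ /eqP <-]; apply: filtration_sqfree.
have [x_sum symbol_sum] := gr_symbol_sum (index_enum _) c x_top.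
have symbol_sum0 : gr_symbol d (\sum_(T | top T) c T *: sqfree_monomial x T) = 0.
  have := congr1 (@hom_component F (gr_sga x) d) c0.
  rewrite raddf0 raddf_sum symbol_sum => component0; rewrite -[RHS]component0.
  rewrite /top big_mkcondr /=; apply: eq_bigr => T _.
  have hT : sga_hom #|T| (sqfree_monomial (gr_gen x) T : gr_sga x).
    rewrite sqfree_monomial_gr_gen; apply/gr_homP; exists (sqfree_monomial x T) => //.
    exact: filtration_sqfree.
  rewrite linearZ /= (hom_component_hom _ hT) eq_sym.
  by case: eqP => [dT|_]; rewrite ?scaler0 // sqfree_monomial_gr_gen dT.
apply: (independent_span_disjoint x_indep (Q1 := top)
    (Q2 := fun T => level_transversal lev T && (#|T| < d)%N)).
- by move=> T /andP[].
- by move=> T /andP[].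
- by move=> T /andP[_ /eqP->]; rewrite ltnn andbF.
- move/(gr_symbol_eq0 x_sum): symbol_sum0; case: (d) => [->|d']; first exact: span0.
  exact: filtration_transversal_span.
- by rewrite /top tT0 /d eqxx.
Qed.

Theorem koszul_gr : koszul (gr_sga x).
Proof.
apply: (@koszul_of_level_relations F (gr_sga x) n (gr_gen x) lev).
- exact: gr_hom_gr_gen.
- exact: gr_hom_span.
- exact: gr_level_relations.
- exact: gr_independent.
Qed.

End AssociatedGraded.

(** * Levels of a supersolvable arrangement *)

Section LinearForms.
Variables (R : realType) (l : nat).
Implicit Types u v w y z : 'rV[R]_l.

Lemma dotE v y : dot v y = (v *m y^T) 0 0.
Proof. by rewrite mxE; apply: eq_bigr => j _; rewrite mxE. Qed.

Lemma dotDl u v y : dot (u + v) y = dot u y + dot v y.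
Proof. by rewrite !dotE mulmxDl mxE. Qed.

Lemma dotZl a v y : dot (a *: v) y = a * dot v y.
Proof. by rewrite !dotE -scalemxAl mxE. Qed.

Lemma dotDr v y z : dot v (y + z) = dot v y + dot v z.
Proof. by rewrite !dotE linearD mulmxDr mxE. Qed.

Lemma dotZr v a y : dot v (a *: y) = a * dot v y.
Proof. by rewrite !dotE linearZ -scalemxAr mxE. Qed.

Lemma submx_of_kernel m (M : 'M[R]_(m, l)) w :
  (forall y, M *m y^T = 0 -> dot w y = 0) -> (w <= M)%MS.
Proof.
move=> kerM; rewrite submxE; move: (cokermx M) (mulmx_coker M) => K MK.
apply/eqP/rowP => j; have := kerM (col j K)^T.
rewrite dotE trmxK colE !mulmxA MK mul0mx -colE => /(_ erefl).
by rewrite !mxE.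
Qed.

Lemma hypI_sub u v w : hyp u `&` hyp v `<=` hyp w -> exists a b, w = a *: u + b *: v.
Proof.
move=> sub; have : (w <= col_mx u v)%MS.
  apply: submx_of_kernel => y; rewrite mul_col_mx -col_mx0 => /eq_col_mx[uy vy].
  by apply: sub; rewrite /hyp /= !dotE uy vy mxE.
rewrite -addsmxE => /sub_addsmxP[[a b] /= ->]; exists (a 0 0), (b 0 0).
by rewrite -!mul_scalar_mx -!mx11_scalar.
Qed.

Lemma hyp_sub u w : hyp u `<=` hyp w -> exists a, w = a *: u.
Proof.
move=> sub; have [|a [b ->]] := @hypI_sub u u w; first by move=> y [/sub].
by exists (a + b); rewrite scalerDl.
Qed.

End LinearForms.

Lemma maximal_chain_mem (d : Order.disp_t) (L : latticeType d) (D : set L) Z :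
  maximal_chain D -> (forall W, D W -> (W <= Z)%O || (Z <= W)%O) -> D Z.
Proof.
move=> [cD mD] DZ; rewrite -(mD (D `|` [set Z])); [by right| |by left].
move=> X Y [DX|->] [DY|->]; last by left.
- exact: cD.
- by apply/orP; apply: DZ.
- by apply/orP; rewrite orbC; apply: DZ.
Qed.

Section Flats.
Variables (R : realType) (l : nat) (A : arrangement R l).
Local Notation n := (nhyp A).
Local Notation L := (intersection_lattice A).
Implicit Types (X Y Z W : L) (i j k : 'I_n).

Lemma hyperplane_sub_inj i j : hyperplane i `<=` hyperplane j -> i = j.
Proof.
move=> /hyp_sub[a jE]; apply: normal_hyp_inj.
have a0 : a != 0.
  by apply: contraNneq (normal_neq0 j) => a0; rewrite jE a0 scale0r.
apply/seteqP; split=> y; rewrite /hyp /= jE dotZl; first by move=> ->; rewrite mulr0.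
by move=> /eqP; rewrite mulf_eq0 (negPf a0) => /eqP.
Qed.

Lemma flat_leP X Y : reflect (val Y `<=` val X) (X <= Y)%O.
Proof. exact: asboolP. Qed.

Lemma whole_spaceP : setT \in flats A.
Proof. by rewrite inE; exists set0 => //; rewrite bigcap_set0. Qed.

Definition whole_space : L := SigSub whole_spaceP.

Lemma whole_space_le X : (whole_space <= X)%O.
Proof. exact/flat_leP. Qed.

Lemma hyperplaneP i : hyperplane i \in flats A.
Proof. by rewrite inE; exists [set i] => //; rewrite bigcap_set1. Qed.

Definition hyperplane_flat i : L := SigSub (hyperplaneP i).
Local Notation H := hyperplane_flat.

Lemma hyperplane_le_whole_space i : (H i <= whole_space)%O = false.
Proof.
apply/flat_leP => /= sub; have := normal_neq0 i.
have [|a ->] := @hyp_sub _ _ 0 (normal i); first by move=> y _; apply: sub.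
by rewrite scaler0 eqxx.
Qed.

Definition hyperplanes_above X : {set 'I_n} := [set i | (H i <= X)%O].
Local Notation above := hyperplanes_above.

Lemma mem_hyperplanes_above i X : (i \in above X) = (H i <= X)%O.
Proof. by rewrite finset.in_set. Qed.

Lemma hyperplanes_aboveS X Y : (above X \subset above Y) = (X <= Y)%O.
Proof.
apply/idP/idP => [/fintype.subsetP sub|XY].
  have [S _ SX] := set_mem (valP X); apply/flat_leP; rewrite -SX => y yY i Si.
  have /sub : i \in above X.
    by rewrite mem_hyperplanes_above; apply/flat_leP => z; rewrite -SX; apply.
  by rewrite mem_hyperplanes_above => /flat_leP; apply.
by apply/fintype.subsetP => i; rewrite !mem_hyperplanes_above => /le_trans; apply.
Qed.

Lemma hyperplanes_above_inj : injective above.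
Proof. by move=> X Y XY; apply: le_anti; rewrite -!hyperplanes_aboveS XY subxx. Qed.

(* Björner, Edelman and Ziegler's description of supersolvability: the
   hyperplanes of each level, restricted to a line along the flat of the lower
   levels, become distinct points. *)
Definition supersolvable_leveling (lev : 'I_n -> nat) : Prop :=
  (forall i j, i != j -> lev i = lev j -> exists2 k, (lev k < lev i)%N &
     hyperplane i `&` hyperplane j `<=` hyperplane k) /\
  (forall i, exists2 u, (forall k, (lev k < lev i)%N -> hyperplane k u) &
     forall j, lev j = lev i -> ~ hyperplane j u).

Section ModularChain.
Variable D : set L.
Hypothesis maxD : maximal_chain D.
Hypothesis distD : forall K, chain K ->
  distributive_in (generated_sublattice (D `|` K)).

Lemma maximal_chain_total X Y : D X -> D Y -> (X <= Y)%O || (Y <= X)%O.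
Proof. by move=> DX DY; apply/orP; apply: maxD.1. Qed.

Lemma ex_greatest_avoiding i : exists X, [/\ D X, ~~ (H i <= X)%O &
  forall W, D W -> ~~ (H i <= W)%O -> (W <= X)%O].
Proof.
pose P (k : nat) := `[< exists X, [/\ D X, ~~ (H i <= X)%O & #|above X| = k] >].
have exP : exists k : nat, P k.
  exists #|above whole_space|; apply/asboolP; exists whole_space.
  split=> //; last by rewrite hyperplane_le_whole_space.
  by apply: maximal_chain_mem maxD _ => W _; rewrite whole_space_le orbT.
have leP (k : nat) : P k -> (k <= n)%N.
  by move=> /asboolP[X [_ _ <-]]; rewrite -[X in (_ <= X)%N]card_ord; apply: max_card.
case: (ex_maxnP exP leP) => _ /asboolP[X [DX HX <-]] maxX; exists X; split=> // W DW HW.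
case/orP: (maximal_chain_total DW DX) => // XW.
suff /eqP/hyperplanes_above_inj -> : above X == above W by [].
by rewrite eqEcard hyperplanes_aboveS XW maxX //; apply/asboolP; exists W.
Qed.

Definition avoiding_flat i : L := sval (cid (ex_greatest_avoiding i)).

Lemma avoiding_flat_chain i : D (avoiding_flat i).
Proof. by have [] := svalP (cid (ex_greatest_avoiding i)). Qed.

Lemma hyperplane_le_avoiding_flat i : (H i <= avoiding_flat i)%O = false.
Proof. by have [_ /negPf] := svalP (cid (ex_greatest_avoiding i)). Qed.

Lemma avoiding_flat_max i W : D W -> ~~ (H i <= W)%O -> (W <= avoiding_flat i)%O.
Proof. by have [_ _] := svalP (cid (ex_greatest_avoiding i)); apply. Qed.

Definition flat_level i : nat := #|above (avoiding_flat i)|.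

Lemma flat_level_eq i j :
  flat_level i = flat_level j -> avoiding_flat i = avoiding_flat j.
Proof.
rewrite /flat_level => ij; apply: hyperplanes_above_inj; apply/eqP.
case/orP: (maximal_chain_total (avoiding_flat_chain i) (avoiding_flat_chain j)).
  by rewrite -hyperplanes_aboveS eqEcard => ->; rewrite ij leqnn.
by rewrite -hyperplanes_aboveS eq_sym eqEcard => ->; rewrite ij leqnn.
Qed.

Lemma flat_level_lt i k : (flat_level k < flat_level i)%N = (H k <= avoiding_flat i)%O.
Proof.
apply/idP/idP => [|HkX].
  apply: contraTT => /(avoiding_flat_max (avoiding_flat_chain i)).
  by rewrite -hyperplanes_aboveS -leqNgt; apply: subset_leq_card.
apply: proper_card; rewrite finset.properEneq hyperplanes_aboveS.
have := hyperplane_le_avoiding_flat k.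
have /orP[ik|->] := maximal_chain_total (avoiding_flat_chain i) (avoiding_flat_chain k).
  by rewrite (le_trans HkX ik).
by move=> kN; rewrite andbT; apply: contraFneq kN => /hyperplanes_above_inj->.
Qed.

Lemma join_avoiding_flat_chain i : D (Order.join (avoiding_flat i) (H i)).
Proof.
apply: maximal_chain_mem maxD _ => W DW; have [HW|HW] := boolP (H i <= W)%O.
  rewrite leUx HW andbT.
  have /orP[->|WX] := maximal_chain_total (avoiding_flat_chain i) DW.
    by rewrite orbT.
  by have := hyperplane_le_avoiding_flat i; rewrite (le_trans HW WX).
by rewrite lexU2 // avoiding_flat_max.
Qed.

Lemma hyperplane_le_join i j : flat_level i = flat_level j ->
  (H i <= Order.join (avoiding_flat j) (H j))%O.
Proof.
move=> ij; apply/negPn/negP => /(avoiding_flat_max (join_avoiding_flat_chain j)).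
rewrite (flat_level_eq ij) => le_X; have := hyperplane_le_avoiding_flat j.
by rewrite (le_trans _ le_X) // leUr.
Qed.

(* Distributivity of the sublattice generated by [D] and [H i <= H i \/ H j]
   forces the rank 2 flat [H i \/ H j] to meet [avoiding_flat i]. *)
Lemma ex_lower_hyperplane i j : i != j -> flat_level i = flat_level j ->
  exists2 k, (flat_level k < flat_level i)%N &
    hyperplane i `&` hyperplane j `<=` hyperplane k.
Proof.
move=> nij ij; pose Y := Order.join (H i) (H j).
have YX : (Y <= Order.join (avoiding_flat i) (H i))%O.
  by rewrite leUx leUr hyperplane_le_join.
have chain_iY : chain [set H i; Y].
  by move=> _ _ [->|->] [->|->]; rewrite ?lexx ?leUl; auto.
have gen W : (D `|` [set H i; Y]) W -> generated_sublattice (D `|` [set H i; Y]) W.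
  exact: sub_gen_smallest.
have YE : Y = Order.join (Order.meet Y (avoiding_flat i)) (H i).
  rewrite -[LHS](meet_idPl YX) (distD chain_iY) ?(meet_idPr (leUl _ _ : H i <= Y)%O) //.
  - by apply: gen; right; right.
  - by apply: gen; left; apply: avoiding_flat_chain.
  - by apply: gen; right; left.
have [/existsP[k /andP[kY kX]]|none] :=
    boolP [exists k, (H k <= Y)%O && (H k <= avoiding_flat i)%O].
  by exists k; [rewrite flat_level_lt|apply/flat_leP: kY].
have meet_trivial : Order.meet Y (avoiding_flat i) = whole_space.
  apply: hyperplanes_above_inj; apply/setP => k.
  rewrite !mem_hyperplanes_above lexI hyperplane_le_whole_space.
  by apply: contraNF none => kYX; apply/existsP; exists k.
have : (H j <= H i)%O.
  apply: (le_trans (leUr (H j) (H i))); rewrite -/Y YE meet_trivial.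
  by rewrite (join_idPr (whole_space_le _)).
by move=> /flat_leP/hyperplane_sub_inj; move/eqP: nij.
Qed.

Lemma ex_transverse_vector i :
  exists2 u, (forall k, (flat_level k < flat_level i)%N -> hyperplane k u) &
    forall j, flat_level j = flat_level i -> ~ hyperplane j u.
Proof.
have /existsNP[u /not_implyP[uX ui]] : ~ (val (avoiding_flat i) `<=` hyperplane i).
  by move=> sub; have /flat_leP := hyperplane_le_avoiding_flat i; apply.
exists u => [k|j ji uj]; first by rewrite flat_level_lt => /flat_leP; apply.
apply: ui; have /flat_leP := hyperplane_le_join (esym ji); apply.
by split=> //; rewrite (flat_level_eq ji).
Qed.

End ModularChain.

Lemma ex_supersolvable_leveling :
  supersolvable L -> exists lev, supersolvable_leveling lev.
Proof.
move=> [D [maxD distD]]; exists (flat_level maxD); split.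
- exact: ex_lower_hyperplane.
- exact: ex_transverse_vector.
Qed.

End Flats.

(** * Heaviside functions on the chambers *)

Section Chambers.
Variables (R : realType) (l : nat) (A : arrangement R l) (F : fieldType).
Local Notation n := (nhyp A).
Implicit Types (y z : 'rV[R]_l) (i : 'I_n).

Definition positive_side i y : bool := 0 < dot (normal i) y.

Lemma dot_continuous (v : 'rV[R]_l) : continuous (dot v).
Proof.
apply: continuous_big => [|j _]; first exact: add_continuous.
move=> y; apply: (@continuousM R _ (fun=> v 0 j) (fun z => z 0 j)).
  exact: cst_continuous.
exact: coord_continuous.
Qed.

Lemma chamber_ofP y : arr_complement A y ->
  connected_component (arr_complement A) y \in chambers A.
Proof. by move=> hy; rewrite inE; exists y. Qed.

Definition chamber_of y (hy : arr_complement A y) : chamber A :=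
  SigSub (chamber_ofP hy).

Lemma chamber_exists (C : chamber A) :
  exists y (hy : arr_complement A y), C = chamber_of hy.
Proof.
have [y hy yC] := set_mem (valP C); exists y, hy.
by apply: val_inj; rewrite /= -yC.
Qed.

Lemma arr_complementP y : arr_complement A y <-> forall i, dot (normal i) y != 0.
Proof.
split=> [hy i|hy [i _ yi]]; last by move/eqP: (hy i); apply.
by apply/eqP => yi; apply: hy; exists i.
Qed.

Lemma heaviside_chamber_of i y (hy : arr_complement A y) :
  heaviside F i (chamber_of hy) = (positive_side i y)%:R.
Proof.
rewrite /heaviside /positive_side; set C := \val _.
have Cy : C y by apply: connected_component_refl.
case: asboolP => [/(_ _ Cy) /= -> //|nC].
case: ltP => // y0; exfalso; apply: nC => z Cz; rewrite /pos_halfspace /= ltNge.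
apply/negP => z0.
have /connected_intervalP itv : connected (dot (normal i) @` C).
  apply: connected_continuous_connected; first exact: component_connected.
  by apply: continuous_subspaceT; apply: dot_continuous.
have [|w Cw w0] := itv _ _ (imageP _ Cz) (imageP _ Cy) 0; first by rewrite z0 ltW.
have /arr_complementP/(_ i) := connected_component_sub Cw.
by rewrite w0 eqxx.
Qed.

End Chambers.

Lemma ex_isolating_radius (R : realFieldType) (I : finType) (t : I -> R) (a : R) :
  exists2 eps, 0 < eps & forall j, t j != a -> eps < `|t j - a|.
Proof.
pose gap := \big[Num.min/1]_(j | t j != a) `|t j - a|.
have gap0 : 0 < gap.
  by apply/bigmin_gtP; split=> // j; rewrite normr_gt0 subr_eq0.
exists (gap / 2) => [|j tj]; first by rewrite divr_gt0.
have gap_le : gap <= `|t j - a| by apply: bigmin_le_cond.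
by apply: lt_le_trans gap_le; lra.
Qed.

Lemma affine_sign_near (R : realFieldType) (c s t a : R) :
  c != 0 -> `|s - a| < `|t - a| ->
  c * (s - t) != 0 /\ (0 < c * (s - t)) = (0 < c * (a - t)).
Proof.
move=> c0; rewrite ltr_norml => /andP[lo hi].
have [ta|at_|ta] := ltgtP t a.
- rewrite ltr0_norm ?subr_lt0 // in lo hi.
  have [st at0] : 0 < s - t /\ 0 < a - t by split; lra.
  by rewrite (pmulr_lgt0 _ st) (pmulr_lgt0 _ at0) mulf_neq0 // (gt_eqF st).
- rewrite gtr0_norm ?subr_gt0 // in lo hi.
  have [st at0] : s - t < 0 /\ a - t < 0 by split; lra.
  by rewrite (nmulr_lgt0 _ st) (nmulr_lgt0 _ at0) mulf_neq0 // (lt_eqF st).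
- by rewrite ta subrr normr0 in lo hi; lra.
Qed.

Section HeavisideIndependence.
Variables (R : realType) (l : nat) (A : arrangement R l) (F : fieldType).
Local Notation n := (nhyp A).
Variable lev : 'I_n -> nat.
Hypothesis lev_ss : supersolvable_leveling lev.
Implicit Types (i j k : 'I_n) (m : nat) (T : {set 'I_n}) (y : 'rV[R]_l).

Definition off_levels m y : Prop := forall k, (lev k < m)%N -> dot (normal k) y != 0.

Definition same_sides m y z : Prop :=
  forall k, (lev k < m)%N -> positive_side k y = positive_side k z.

Lemma ex_unit_transverse_vector i : exists u,
  [/\ dot (normal i) u = 1, forall k, (lev k < lev i)%N -> dot (normal k) u = 0 &
      forall j, lev j = lev i -> dot (normal j) u != 0].
Proof.
have [u low_u lev_u] := lev_ss.2 i.
have ui : dot (normal i) u != 0 by apply/eqP/lev_u.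
exists ((dot (normal i) u)^-1 *: u); split=> [|k ki|j ji]; rewrite dotZr.
- by rewrite mulVf.
- by rewrite (low_u k ki : dot _ _ = 0) mulr0.
- by rewrite mulf_neq0 ?invr_eq0 //; apply/eqP/lev_u.
Qed.

(* Crossing [hyperplane i] along a line parallel to the flat of the lower
   levels: the other hyperplanes of the same level are met elsewhere, because
   two of them only meet inside a hyperplane of lower level. *)
Lemma ex_crossing_points i y : off_levels (lev i) y -> exists y1 y2,
  [/\ off_levels (lev i).+1 y1 /\ off_levels (lev i).+1 y2,
      same_sides (lev i) y1 y,
      forall k, (lev k <= lev i)%N -> k != i -> positive_side k y1 = positive_side k y2,
      positive_side i y1 & ~~ positive_side i y2].
Proof.
move=> off_y; have [u [ui low_u lev_u]] := ex_unit_transverse_vector i.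
pose line s := y + s *: u; pose t j := - dot (normal j) y / dot (normal j) u.
have low_line k s : (lev k < lev i)%N -> dot (normal k) (line s) = dot (normal k) y.
  by move=> ki; rewrite dotDr dotZr low_u // mulr0 addr0.
have lev_line j s : lev j = lev i ->
    dot (normal j) (line s) = dot (normal j) u * (s - t j).
  by move=> /lev_u uj; rewrite dotDr dotZr /t; field.
have i_line s : dot (normal i) (line s) = s - t i by rewrite lev_line // ui mul1r.
have t_neq j : lev j = lev i -> j != i -> t j != t i.
  move=> ji nji; apply/eqP => tji; have [k ki sub] := lev_ss.1 j i nji ji.
  rewrite ji in ki; have /eqP := off_y k ki; rewrite -(low_line k (t i)) //; apply.
  by apply: sub; rewrite /hyperplane /hyp /= !lev_line // tji subrr !mulr0.
have [eps eps0 isolated] := ex_isolating_radius t (t i).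
have near s k : `|s - t i| = eps -> (lev k <= lev i)%N -> k != i ->
    dot (normal k) (line s) != 0 /\
    positive_side k (line s) = positive_side k (line (t i)).
  rewrite leq_eqVlt /positive_side => s_eps /orP[/eqP ki nki|ki _].
    rewrite !lev_line //; apply: affine_sign_near; first exact: lev_u.
    by rewrite s_eps isolated ?t_neq.
  by rewrite !low_line //; split=> //; apply: off_y.
have off_line s : `|s - t i| = eps -> off_levels (lev i).+1 (line s).
  move=> s_eps k ki; have [->|nki] := eqVneq k i; last by have [] := near s k s_eps.
  by rewrite i_line -normr_eq0 s_eps gt_eqF.
have right_eps : `|t i + eps - t i| = eps by rewrite addrAC subrr add0r gtr0_norm.
have left_eps : `|t i - eps - t i| = eps by rewrite addrAC subrr add0r normrN gtr0_norm.
exists (line (t i + eps)), (line (t i - eps)); split.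
- by split; apply: off_line.
- by move=> k ki; rewrite /positive_side low_line.
- by move=> k ki nki; rewrite (near _ k right_eps _ _).2 // (near _ k left_eps _ _).2.
- by rewrite /positive_side i_line; lra.
- by rewrite /positive_side i_line; apply/negP => ?; lra.
Qed.

Lemma ex_off_next_level m y : off_levels m y ->
  exists2 z, off_levels m.+1 z & same_sides m z y.
Proof.
move=> off_y; have [/existsP[i /eqP im]|none] := boolP [exists i, lev i == m].
  rewrite -im in off_y *; have [z [_ [[off_z _] zy _ _ _]]] := ex_crossing_points off_y.
  by exists z.
exists y => // k; rewrite ltnS leq_eqVlt => /orP[km|]; last exact: off_y.
by case/negP: none; apply/existsP; exists k.
Qed.

Definition transversal_below m T : bool :=
  level_transversal lev T && [forall k in T, (lev k < m)%N].

Lemma transversal_below_lt m T k : transversal_below m T -> k \in T -> (lev k < m)%N.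
Proof. by move=> /andP[_ /forall_inP]; apply. Qed.

Lemma transversal_belowS m T : transversal_below m T -> transversal_below m.+1 T.
Proof.
move=> tT; have /andP[tT' _] := tT; rewrite /transversal_below tT'.
by apply/forall_inP => k kT; rewrite ltnW // ltnS (transversal_below_lt tT).
Qed.

Lemma transversal_below0 T : transversal_below 0 T = (T == finset.set0).
Proof.
apply/idP/eqP => [tT|->].
  by apply/setP => k; rewrite finset.in_set0; apply/negP => /(transversal_below_lt tT).
apply/andP; split; first by apply/dinjectiveP => i j; rewrite finset.in_set0.
by apply/forall_inP => i; rewrite finset.in_set0.
Qed.

Lemma transversal_belowU1 i T :
  (i \notin T) && transversal_below (lev i).+1 (i |: T) = transversal_below (lev i) T.
Proof.
apply/andP/idP => [[iT tU]|tT].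
  have /andP[/[dup] tU' /dinjectiveP lev_inj _] := tU; apply/andP; split.
    by apply: level_transversalS tU'; apply: finset.subsetUr.
  apply/forall_inP => k kT; have kU : k \in i |: T by rewrite finset.in_setU1 kT orbT.
  rewrite ltn_neqAle -ltnS (transversal_below_lt tU kU) andbT.
  by apply: contraNneq iT => /lev_inj <- //; rewrite finset.setU11.
have iT : i \notin T by apply/negP => /(transversal_below_lt tT); rewrite ltnn.
split=> //; apply/andP; split.
  have /andP[tT' _] := tT; apply: level_transversalU1 => // k.
  by move=> /(transversal_below_lt tT); rewrite neq_ltn => ->.
apply/forall_inP => k; rewrite finset.in_setU1 => /orP[/eqP->//|].
by move=> /(transversal_below_lt tT)/ltnW.
Qed.

Lemma ex_top_level m T : transversal_below m.+1 T -> ~~ transversal_below m T ->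
  exists2 i, i \in T & lev i = m.
Proof.
move=> tT; have /andP[tT' _] := tT; rewrite /transversal_below tT' /=.
move=> /forall_inPn[i iT]; rewrite -leqNgt => im; exists i => //.
by apply/eqP; rewrite eqn_leq im -ltnS (transversal_below_lt tT).
Qed.

Definition indicator_monomial T y : F := \prod_(k in T) (positive_side k y)%:R.

Definition indicator_sum m (c : {set 'I_n} -> F) y : F :=
  \sum_(T | transversal_below m T) c T * indicator_monomial T y.

Lemma eq_indicator_monomial T y z :
  (forall k, k \in T -> positive_side k y = positive_side k z) ->
  indicator_monomial T y = indicator_monomial T z.
Proof. by move=> yz; apply: eq_bigr => k /yz->. Qed.

Lemma indicator_monomialU1 i T y : i \notin T ->
  indicator_monomial (i |: T) y = (positive_side i y)%:R * indicator_monomial T y.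
Proof. exact: big_setU1. Qed.

Lemma indicator_sum_jump i c y y1 y2 : same_sides (lev i) y1 y ->
  (forall k, (lev k <= lev i)%N -> k != i -> positive_side k y1 = positive_side k y2) ->
  positive_side i y1 -> ~~ positive_side i y2 ->
  indicator_sum (lev i).+1 c y1 - indicator_sum (lev i).+1 c y2 =
  indicator_sum (lev i) (fun T => c (i |: T)) y.
Proof.
move=> y1y y12 i1 i2; rewrite /indicator_sum -sumrB (bigID (fun T => i \in T)) /=.
rewrite [X in _ + X]big1 ?addr0 => [|T /andP[tT iT]]; last first.
  rewrite (@eq_indicator_monomial T y1 y2) ?subrr // => k kT.
  apply: y12; first exact: (transversal_below_lt tT).
  by apply: contraNneq iT => <-.
under eq_bigl do rewrite andbC.
rewrite big_set_in; apply: eq_big => [T|T]; rewrite transversal_belowU1 // => tT.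
have iT : i \notin T by apply/negP => /(transversal_below_lt tT); rewrite ltnn.
rewrite !indicator_monomialU1 // i1 (negPf i2) mul0r mul1r mulr0 subr0.
congr (_ * _); apply: eq_indicator_monomial => k kT.
exact/y1y/(transversal_below_lt tT).
Qed.

Lemma indicator_sum_below m c y z : same_sides m z y ->
  (forall T, transversal_below m.+1 T -> ~~ transversal_below m T -> c T = 0) ->
  indicator_sum m.+1 c z = indicator_sum m c y.
Proof.
move=> zy c0; rewrite /indicator_sum (bigID (transversal_below m)) /=.
rewrite [X in _ + X]big1 ?addr0 => [|T /andP[tT tN]]; last by rewrite c0 ?mul0r.
apply: eq_big => [T|T /andP[_ tT]]; first exact/andb_idl/transversal_belowS.
congr (_ * _); apply: eq_indicator_monomial => k kT.
exact/zy/(transversal_below_lt tT).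
Qed.

Lemma indicator_sum_eq0 m c : (forall y, off_levels m y -> indicator_sum m c y = 0) ->
  forall T, transversal_below m T -> c T = 0.
Proof.
elim: m c => [|m IHm] c c0 T tT.
  have off0 : off_levels 0 0 by [].
  have := c0 0 off0; rewrite /indicator_sum.
  rewrite (big_pred1 _ transversal_below0) /indicator_monomial big_set0 mulr1.
  by move: tT; rewrite transversal_below0 => /eqP->.
have top S : transversal_below m.+1 S -> ~~ transversal_below m S -> c S = 0.
  move=> tS /(ex_top_level tS)[i iS im]; rewrite -im in c0 IHm tS.
  rewrite -(finset.setD1K iS); apply: (IHm (fun S => c (i |: S))) => [y off_y|].
    have [y1 [y2 [[off1 off2] y1y y12 i1 i2]]] := ex_crossing_points off_y.
    by rewrite -(indicator_sum_jump c y1y y12 i1 i2) !c0 // subrr.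
  by rewrite -transversal_belowU1 finset.setD11 finset.setD1K.
have [{}tT|] := boolP (transversal_below m T); last exact: top.
apply: (IHm c) tT => y /ex_off_next_level[z off_z zy].
by rewrite -(indicator_sum_below zy top) c0.
Qed.

Lemma sqfree_heaviside_chamber_of T y (hy : arr_complement A y) :
  sqfree_monomial (heaviside F) T (chamber_of hy) = indicator_monomial T y.
Proof.
pose eval (f : VG A F) := f (chamber_of hy).
have evalM : {morph eval : f g / f * g} by [].
rewrite -/(eval _) (big_morph eval evalM (erefl : eval 1 = 1)).
by apply: eq_bigr => k _; apply: heaviside_chamber_of.
Qed.

Lemma heaviside_independent :
  independent (sqfree_monomial (heaviside F)) (level_transversal lev).
Proof.
move=> c c0 T tT; pose m := (\max_k lev k).+1.
have below_m S : transversal_below m S = level_transversal lev S.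
  by apply: andb_idr => _; apply/forall_inP => k _; rewrite ltnS leq_bigmax.
apply: (@indicator_sum_eq0 m c); last by rewrite below_m.
move=> y off_y; have hy : arr_complement A y.
  by apply/arr_complementP => k; apply: off_y; rewrite ltnS leq_bigmax.
have := congr1 (fun f : chamber A -> F => f (chamber_of hy)) c0.
rewrite fct_sumE => sum0; rewrite -[RHS]sum0.
apply: eq_big => [S|S _]; first exact: below_m.
rewrite -[RHS]/(c S * sqfree_monomial (heaviside F) S (chamber_of hy)).
by rewrite sqfree_heaviside_chamber_of.
Qed.

End HeavisideIndependence.

Section Indicators.
Variables (R : realDomainType) (F : comNzRingType).

Lemma indicatorM (u v : R) : u != 0 -> v != 0 ->
  (0 < u)%R%:R * (0 < v)%R%:R =
  (0 < u + v)%R%:R * (0 < u)%R%:R + (0 < u + v)%R%:R * (0 < v)%R%:R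
    - (0 < u + v)%R%:R :> F.
Proof.
move=> u0 v0.
case: (ltgtP 0 u) u0 => //= u_sgn _; case: (ltgtP 0 v) v0 => //= v_sgn _.
- by rewrite addr_gt0 //= !mulr1 addrK.
- by rewrite mulr1 !mulr0 addr0 subrr.
- by rewrite mul0r mulr0 mulr1 add0r subrr.
- have uv_lt : u + v < 0 by lra.
  by rewrite (lt_gtF uv_lt) /= !mul0r subr0 addr0.
Qed.

Definition orient (b : bool) (X : F) : F := if b then 1 - X else X.

Lemma indicator_scale (p u : R) : p != 0 -> u != 0 ->
  (0 < p * u)%R%:R = orient (p < 0) (0 < u)%R%:R :> F.
Proof.
rewrite neq_lt /orient => /orP[p0|p0] u0; last first.
  by rewrite pmulr_rgt0 // (lt_gtF p0).
rewrite nmulr_rgt0 // p0.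
by case: (ltgtP 0 u) u0 => //= _ _; rewrite ?subrr ?subr0.
Qed.

Lemma orientM b c (X Y Z : F) :
  orient b X * orient c Y = Z * orient b X + Z * orient c Y - Z ->
  X * Y = (-1) ^+ c * (Z * X) + (-1) ^+ b * (Z * Y) + (-1) ^+ (b (+) c) *
    ((b%:R + c%:R - 1) * Z - b%:R * c%:R - b%:R * (-1) ^+ c * Y - c%:R * (-1) ^+ b * X).
Proof.
move=> /eqP; rewrite -subr_eq0 => /eqP rel; apply: subr0_eq.
rewrite -[RHS](mulr0 ((-1) ^+ (b (+) c))) -rel /orient.
by case: b {rel}; case: c; rewrite /= ?expr0 ?expr1; ring.
Qed.

End Indicators.

Section HeavisideRelations.
Variables (R : realType) (l : nat) (A : arrangement R l) (F : fieldType).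
Local Notation n := (nhyp A).
Local Notation x := (@heaviside R l A F).
Implicit Types i j k : 'I_n.

(* For suitable orientations of [hyperplane i] and [hyperplane j], the form of
   [hyperplane k] is a positive combination of theirs, and then
   [x i * x j = x k * x i + x k * x j - x k]. *)
Lemma heaviside_relation i j k (p q : R) : p != 0 -> q != 0 ->
  normal k = p *: normal i + q *: normal j ->
  exists a b : F, filtration x 1 (x i * x j - (a *: (x k * x i) + b *: (x k * x j))).
Proof.
move=> p0 q0 kE; exists ((-1) ^+ (q < 0)%R), ((-1) ^+ (p < 0)%R).
set s : F := (-1) ^+ ((p < 0)%R (+) (q < 0)%R).
set a : F := (-1) ^+ (q < 0)%R; set b : F := (-1) ^+ (p < 0)%R.
set cp : F := (p < 0)%R%:R; set cq : F := (q < 0)%R%:R.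
have -> : x i * x j = a *: (x k * x i) + b *: (x k * x j) +
    s *: ((cp + cq - 1) *: x k - (cp * cq) *: 1 - (cp * a) *: x j - (cq * b) *: x i).
  apply: boolp.funext => C; have [y [hy ->]] := chamber_exists C.
  have /arr_complementP off := hy.
  have := @indicatorM _ F (p * dot (normal i) y) (q * dot (normal j) y).
  rewrite -!dotZl -dotDl -kE !dotZl !mulf_neq0 ?off // !indicator_scale ?off //.
  move=> /(_ isT isT).
  rewrite -!/(positive_side _ _) -!(heaviside_chamber_of F _ hy).
  by move=> /orientM xM; rewrite -[LHS]/(x i _ * x j _) xM -[X in _ - X - _ - _]mulr1.
have x1 : filtration x 1 1 by apply: filtration_le (filtration1 x).
rewrite addrAC subrr add0r; apply: spanZ.
by do ![apply: spanD|apply: spanN|apply: spanZ => //]; apply: filtration_gen.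
Qed.

Lemma heaviside_sq i : filtration x 1 (x i * x i).
Proof.
have -> : x i * x i = x i; last exact: filtration_gen.
apply: boolp.funext => C; rewrite -[LHS]/(x i C * x i C) /heaviside.
by case: asboolP => _; rewrite ?mulr1 ?mulr0.
Qed.

Lemma normal_combination i j k : i != j -> k != i -> k != j ->
  hyperplane i `&` hyperplane j `<=` hyperplane k ->
  exists p q, [/\ p != 0, q != 0 & normal k = p *: normal i + q *: normal j].
Proof.
move=> ij ki kj /hypI_sub[p [q kE]]; exists p, q.
have not_multiple (h : 'I_n) a : k != h -> normal k != a *: normal h.
  apply: contra_neqN => /eqP khE; apply/esym/hyperplane_sub_inj => y.
  by rewrite /hyperplane /hyp /= khE dotZl => ->; rewrite mulr0.
split=> //.
  by apply: contraNneq (not_multiple j q kj) => p0; rewrite kE p0 scale0r add0r.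
by apply: contraNneq (not_multiple i p ki) => q0; rewrite kE q0 scale0r addr0.
Qed.

Lemma heaviside_level_relations lev :
  supersolvable_leveling lev -> level_relations lev (filtration x 1) x.
Proof.
move=> [lev_pair _]; split=> [i|i j nij ij]; first exact: heaviside_sq.
have [k ki sub] := lev_pair i j nij ij.
have nki : k != i by apply: contraTneq ki => ->; rewrite ltnn.
have nkj : k != j by apply: contraTneq ki => ->; rewrite ij ltnn.
have [p [q [p0 q0 kE]]] := normal_combination nij nki nkj sub.
by have [a [b rel]] := heaviside_relation p0 q0 kE; exists k, a, b.
Qed.

End HeavisideRelations.

Theorem theorem1p3 (F : fieldType) (R : realType) (l : nat)
    (A : arrangement R l) :
  supersolvable (intersection_lattice A) -> koszul (VG_gr A F).
Proof.
move=> /ex_supersolvable_leveling[lev lev_ss]; apply: (koszul_gr (lev := lev)).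
- exact: heaviside_level_relations.
- exact: heaviside_independent.
Qed.
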